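(* Let $\Delta\ge 0$, let $n,m\ge 1$ be integers, and let $f:\mathcal X^n\times\mathbb R^m\to\mathbb R^n$ be Lipschitz on bounded sets with $f(0,0)=0$. The system $\dot x(t)=f(x_t,u(t))$ is exp-ISS if and only if there exist constants $\ell,T>0$, $\lambda\in(0,1)$ and a function $\mu\in\mathcal N$ such that, for all $x_0\in\mathcal W^n$ and all $u\in\mathcal U^m$, its corresponding solution (exists on $[0,T]$ and) satisfies $$\|x_t\|\le \ell\|x_0\|+\mu\left(\|u_{[0,t]}\|\right),\quad\forall t\in[0,T],$$ $$\|x_T\|\le \lambda\|x_0\|+\mu\left(\|u_{[0,T]}\|\right).$$ Moreover, the system $\dot x(t)=f(x_t,u(t))$ is exp-ISS with linear gain if and only if there exist constants $\ell,T>0$, $\lambda\in(0,1)$ and a linear function $\mu\in\mathcal N$ (i.e. $\mu(s)=\mu_0 s$ for all $s\ge 0$, for some $\mu_0\ge 0$) such that, for all $x_0\in\mathcal W^n$ and all $u\in\mathcal U^m$, its corresponding solution (exists on $[0,T]$ and) satisfies $\|x_t\|\le \ell\|x_0\|+\mu\left(\|u_{[0,t]}\|\right)$ for all $t\in[0,T]$ and $\|x_T\|\le \lambda\|x_0\|+\mu\left(\|u_{[0,T]}\|\right)$.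
   Context: $\mathcal X^n$ is the set of continuous functions $\phi:[-\Delta,0]\to\mathbb R^n$, with $\|\phi\|=\max_{\tau\in[-\Delta,0]}|\phi(\tau)|$, where $|\cdot|$ is the Euclidean norm. $\mathcal W^n\subset\mathcal X^n$ is the set of absolutely continuous functions $[-\Delta,0]\to\mathbb R^n$ with essentially bounded derivative. A map is Lipschitz on bounded sets if its restriction to every bounded set is Lipschitz. $\mathcal U^m$ is the set of Lebesgue measurable, locally essentially bounded signals $u:\mathbb R_{\ge 0}\to\mathbb R^m$; $u_{[0,t]}$ is the restriction of $u$ to $[0,t]$ and $\|u_{[0,t]}\|$ its essential supremum norm. For a continuous $x:[-\Delta,T)\to\mathbb R^n$ and $t\in[0,T)$, $x_t\in\mathcal X^n$ is $x_t(\tau):=x(t+\tau)$, $\tau\in[-\Delta,0]$. For an initial state $x_0\in\mathcal X^n$ and $u\in\mathcal U^m$, the solution of $\dot x(t)=f(x_t,u(t))$ is the (unique, maximal) locally absolutely continuous solution, the equation holding for almost every $t\geq 0$ in the existence interval. Class $\mathcal N$: functions $\mathbb R_{\ge 0}\to\mathbb R_{\ge 0}$ that are continuous, non-decreasing and zero at zero. Exp-ISS: the system is exp-ISS if there exist $k,\eta>0$ and $\mu\in\mathcal N$ such that, for all $x_0\in\mathcal X^n$ and all $u\in\mathcal U^m$, the solution exists for all $t\ge 0$ and satisfies $|x(t)|\le k\|x_0\|e^{-\eta t}+\mu(\|u_{[0,t]}\|)$ for all $t\ge 0$. It is exp-ISS with linear gain if this holds with $\mu(s)=\mu_0 s$ for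 some $\mu_0\ge 0$. *)

(* Defs.v *)
From HB Require Import structures.
From mathcomp Require Import all_boot all_order all_algebra.
From mathcomp Require Import all_classical all_reals all_analysis.
From mathcomp Require Import measurable_realfun ess_sup_inf.

Set Implicit Arguments.
Unset Strict Implicit.
Unset Printing Implicit Defensive.

Import Order.TTheory GRing.Theory Num.Theory.
Import numFieldNormedType.Exports.

Local Open Scope classical_set_scope.
Local Open Scope ring_scope.

(* R^n is 'rV[R]_n.  Functions on [-Delta, 0], [0, +oo[ or [-Delta, b[ are
   represented by total functions on R, of which only the restriction to the
   relevant interval matters. *)

Section Spaces.
Variable R : realType.

(* The norm `|v| of 'rV[R]_n in the library is the sup norm; it induces the same
   topology, hence the same continuity and derivatives, as the Euclidean one. *)
Definition enorm n (v : 'rV[R]_n) : R := Num.sqrt (\sum_(i < n) v 0 i ^+ 2).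

Definition hist_space (Delta : R) n : set (R -> 'rV[R]_n) :=
  [set phi | {within `[- Delta, 0], continuous phi}].

Definition hist_norm (Delta : R) n (phi : R -> 'rV[R]_n) : R :=
  sup [set enorm (phi tau) | tau in `[- Delta, 0]].

Definition hist n (x : R -> 'rV[R]_n) (t : R) : R -> 'rV[R]_n :=
  fun tau => x (t + tau).

Definition abs_continuous n (x : R -> 'rV[R]_n) (a b : R) : Prop :=
  forall e : R, 0 < e -> exists2 d : R, 0 < d &
    forall (N : nat) (s t : 'I_N -> R),
      (forall i, a <= s i /\ s i <= t i /\ t i <= b) ->
      trivIset setT (fun i => `]s i, t i[%classic) ->
      \sum_(i < N) (t i - s i) < d ->
      \sum_(i < N) enorm (x (t i) - x (s i)) < e.

Definition ac_hist_space (Delta : R) n : set (R -> 'rV[R]_n) :=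
  [set phi | abs_continuous phi (- Delta) 0 /\
    exists M : R, {ae @lebesgue_measure R, forall tau, - Delta < tau < 0 ->
      derivable phi tau 1 /\ enorm ('D_1 phi tau) <= M}].

(* Equal to 0 for t = 0. *)
Definition ess_norm m (u : R -> 'rV[R]_m) (t : R) : \bar R :=
  ess_sup (@lebesgue_measure R)
    (fun s => (if 0 <= s <= t then enorm (u s) else 0)%:E).

(* The sigma-algebra of Lebesgue measurable sets (measurableTypeR R only carries
   the Borel sets). *)
Definition lebesgueTypeR : measurableType _ :=
  g_sigma_algebraType (completed_algebra_gen (@lebesgue_measure R)).

Definition input_space m : set (R -> 'rV[R]_m) :=
  [set u : R -> 'rV[R]_m | (forall i : 'I_m, measurable_fun (`[0, +oo[ : set lebesgueTypeR)
              (fun t => u t 0 i : measurableTypeR R)) /\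
           (forall t : R, 0 <= t -> (ess_norm u t < +oo)%E)].

Definition lipschitz_on_bounded (Delta : R) n m p
    (f : (R -> 'rV[R]_n) -> 'rV[R]_m -> 'rV[R]_p) : Prop :=
  forall B : set ((R -> 'rV[R]_n) * 'rV[R]_m),
    (forall z, B z -> hist_space Delta z.1) ->
    (exists M : R, forall z, B z ->
       hist_norm Delta z.1 <= M /\ enorm z.2 <= M) ->
    exists L : R, forall z w, B z -> B w ->
      enorm (f z.1 z.2 - f w.1 w.2) <=
      L * (hist_norm Delta (z.1 \- w.1) + enorm (z.2 - w.2)).

(* When x0 is continuous, a solution x is continuous on [-Delta, b[, so that
   hist x t belongs to hist_space Delta for every t in [0, b[. *)
Definition is_solution (Delta : R) n m
    (f : (R -> 'rV[R]_n) -> 'rV[R]_m -> 'rV[R]_n)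
    (x0 : R -> 'rV[R]_n) (u : R -> 'rV[R]_m) (b : \bar R)
    (x : R -> 'rV[R]_n) : Prop :=
  [/\ (0 < b)%E,
      forall tau, - Delta <= tau <= 0 -> x tau = x0 tau,
      forall t, 0 <= t -> (t%:E < b)%E -> abs_continuous x 0 t
    & {ae @lebesgue_measure R, forall t, 0 <= t -> (t%:E < b)%E ->
        is_derive t 1 x (f (hist x t) (u t))}].

(* x, with existence interval [0, b[, is the unique maximal solution: every
   solution is a restriction of it. *)
Definition is_max_solution (Delta : R) n m
    (f : (R -> 'rV[R]_n) -> 'rV[R]_m -> 'rV[R]_n)
    (x0 : R -> 'rV[R]_n) (u : R -> 'rV[R]_m) (b : \bar R)
    (x : R -> 'rV[R]_n) : Prop :=
  is_solution Delta f x0 u b x /\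
  forall (c : \bar R) (y : R -> 'rV[R]_n), is_solution Delta f x0 u c y ->
    (c <= b)%E /\ forall t, 0 <= t -> (t%:E < c)%E -> y t = x t.

Definition classN (mu : R -> R) : Prop :=
  [/\ {within `[0, +oo[, continuous mu},
      forall s, 0 <= s -> 0 <= mu s,
      forall s t, 0 <= s -> s <= t -> mu s <= mu t
    & mu 0 = 0].

Definition exp_ISS_with (Delta : R) n m
    (f : (R -> 'rV[R]_n) -> 'rV[R]_m -> 'rV[R]_n) (mu : R -> R) : Prop :=
  exists k eta : R, [/\ 0 < k, 0 < eta &
    forall (x0 : R -> 'rV[R]_n) (u : R -> 'rV[R]_m),
      hist_space Delta x0 -> input_space u ->
      exists2 x, is_max_solution Delta f x0 u +oo%E x &
        forall t, 0 <= t ->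
          enorm (x t) <= k * hist_norm Delta x0 * expR (- eta * t)
                         + mu (fine (ess_norm u t))].

Definition exp_ISS (Delta : R) n m
    (f : (R -> 'rV[R]_n) -> 'rV[R]_m -> 'rV[R]_n) : Prop :=
  exists2 mu, classN mu & exp_ISS_with Delta f mu.

Definition exp_ISS_linear_gain (Delta : R) n m
    (f : (R -> 'rV[R]_n) -> 'rV[R]_m -> 'rV[R]_n) : Prop :=
  exists2 mu0 : R, 0 <= mu0 & exp_ISS_with Delta f (fun s => mu0 * s).

Definition finite_time_estimate (Delta : R) n m
    (f : (R -> 'rV[R]_n) -> 'rV[R]_m -> 'rV[R]_n)
    (l T lambda : R) (mu : R -> R) : Prop :=
  forall (x0 : R -> 'rV[R]_n) (u : R -> 'rV[R]_m),
    ac_hist_space Delta x0 -> input_space u ->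
    exists (b : \bar R) (x : R -> 'rV[R]_n),
      [/\ is_max_solution Delta f x0 u b x,
          (T%:E < b)%E,
          forall t, 0 <= t <= T ->
            hist_norm Delta (hist x t) <=
              l * hist_norm Delta x0 + mu (fine (ess_norm u t))
        & hist_norm Delta (hist x T) <=
            lambda * hist_norm Delta x0 + mu (fine (ess_norm u T))].

End Spaces.

(* Main.v *)
Require Import Defs.
From mathcomp Require Import all_boot all_order all_algebra.
From mathcomp Require Import all_classical all_reals all_analysis.
From mathcomp Require Import measurable_realfun ess_sup_inf.
From mathcomp Require Import ring lra.

(* Only data from the dense space W^n are controlled by the estimates, so
   solutions from x_0 in X^n are obtained as limits of solutions X_k from
   approximations of x_0 in W^n.  On [0, T] these stay in a ball on which f is
   Lipschitz, so a Gronwall argument bounds X_k - X_j, and hence its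
   derivative: X_k - X_j has a small Lipschitz constant.  The limit x therefore
   differs from X_k by a function with Lipschitz constant tending to 0, so it is
   absolutely continuous, is differentiable wherever all the X_k are, and
   solves the equation there; neither an integral nor a local existence theorem
   is needed.  The two estimates pass to the limit.  Concatenating such solutions
   over successive periods gives |x_(NT)| <= lambda^N |x_0| + mu / (1 - lambda),
   and lambda^N is exponential decay in time.  Conversely, exp-ISS gives the
   contraction over a period T > Delta with k exp(-eta (T - Delta)) < 1.

   The only measure-theoretic tool is a mean value inequality for absolutely
   continuous functions with an almost everywhere derivative bound. *)

Set Implicit Arguments.
Unset Strict Implicit.
Unset Printing Implicit Defensive.
Import Order.TTheory GRing.Theory Num.Theory.
Import numFieldNormedType.Exports.
Local Open Scope classical_set_scope.
Local Open Scope ring_scope.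

(** * Euclidean norm: Cauchy-Schwarz, triangle inequality, comparison with the sup norm *)

Section EuclideanNorm.
Variables (R : realType) (n : nat).
Implicit Types v w : 'rV[R]_n.

Lemma enorm_ge0 v : 0 <= enorm v.
Proof. exact: sqrtr_ge0. Qed.

Lemma sqr_enorm v : enorm v ^+ 2 = \sum_(i < n) v 0 i ^+ 2.
Proof. by rewrite sqr_sqrtr// sumr_ge0// => i _; exact: sqr_ge0. Qed.

Lemma enormZ a v : enorm (a *: v) = `|a| * enorm v.
Proof.
rewrite /enorm -sqrtr_sqr -sqrtrM ?sqr_ge0//; congr Num.sqrt.
by rewrite mulr_sumr; apply: eq_bigr => i _; rewrite mxE exprMn.
Qed.

Lemma enorm0 : enorm (0 : 'rV[R]_n) = 0.
Proof. by rewrite -(scale0r 0) enormZ normr0 mul0r. Qed.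

Lemma enormN v : enorm (- v) = enorm v.
Proof. by rewrite -scaleN1r enormZ normrN1 mul1r. Qed.

Lemma enormBC v w : enorm (v - w) = enorm (w - v).
Proof. by rewrite -enormN opprB. Qed.

Lemma norm_coord_le_enorm v i : `|v 0 i| <= enorm v.
Proof.
rewrite -sqrtr_sqr ler_wsqrtr// (bigD1 i)//= lerDl sumr_ge0// => j _.
exact: sqr_ge0.
Qed.

Lemma enorm0_eq0 v : enorm v = 0 -> v = 0.
Proof.
move=> v0; apply/rowP => i; rewrite mxE; apply/eqP; rewrite -normr_le0 -v0.
exact: norm_coord_le_enorm.
Qed.

(** The squared norm of [enorm w *: v - enorm v *: w] is nonnegative; expanding it and dividing by
    [enorm v * enorm w] gives the bound. Zero vectors are set apart to allow the division. *)
Lemma enorm_cauchy_schwarz v w :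
  \sum_(i < n) v 0 i * w 0 i <= enorm v * enorm w.
Proof.
have [/enorm0_eq0 ->|v0] := eqVneq (enorm v) 0.
  by rewrite enorm0 mul0r big1// => i _; rewrite mxE mul0r.
have [/enorm0_eq0 ->|w0] := eqVneq (enorm w) 0.
  by rewrite enorm0 mulr0 big1// => i _; rewrite mxE mulr0.
have vw_gt0 : 0 < enorm v * enorm w.
  by rewrite mulr_gt0// lt_def enorm_ge0 ?v0 ?w0.
have : 0 <= \sum_(i < n) (enorm w * v 0 i - enorm v * w 0 i) ^+ 2.
  by rewrite sumr_ge0// => i _; exact: sqr_ge0.
have -> : \sum_(i < n) (enorm w * v 0 i - enorm v * w 0 i) ^+ 2 =
    enorm w ^+ 2 * (\sum_(i < n) v 0 i ^+ 2)
    - (enorm v * enorm w) * (\sum_(i < n) v 0 i * w 0 i) *+ 2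
    + enorm v ^+ 2 * (\sum_(i < n) w 0 i ^+ 2).
  rewrite -mulrnAr -sumrMnl !mulr_sumr -sumrB -big_split; apply: eq_bigr => i _ /=.
  by ring.
rewrite -!sqr_enorm => h; rewrite -(ler_pM2l vw_gt0); nra.
Qed.

Lemma ler_enormD v w : enorm (v + w) <= enorm v + enorm w.
Proof.
rewrite -(@ler_pXn2r _ 2)// ?nnegrE ?addr_ge0 ?enorm_ge0//.
have -> : enorm (v + w) ^+ 2 =
    enorm v ^+ 2 + (\sum_(i < n) v 0 i * w 0 i) *+ 2 + enorm w ^+ 2.
  rewrite !sqr_enorm -sumrMnl -!big_split; apply: eq_bigr => i _ /=.
  by rewrite mxE; ring.
have := enorm_cauchy_schwarz v w; nra.
Qed.

Lemma ler_enormB v w : enorm (v - w) <= enorm v + enorm w.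
Proof. by rewrite -(enormN w) ler_enormD. Qed.

Lemma ler_enorm_distD u v w : enorm (v - w) <= enorm (v - u) + enorm (u - w).
Proof. by rewrite -[v - w](subrKA u) ler_enormD. Qed.

Lemma enorm_le_sum v : enorm v <= \sum_(i < n) `|v 0 i|.
Proof.
have S0 : 0 <= \sum_(i < n) `|v 0 i| by rewrite sumr_ge0.
rewrite -(@ler_pXn2r _ 2)// ?nnegrE ?enorm_ge0// sqr_enorm expr2 mulr_suml.
apply: ler_sum => i _; rewrite -[v 0 i ^+ 2]ger0_norm ?sqr_ge0// expr2 normrM.
by rewrite ler_wpM2l// (bigD1 i)//= lerDl sumr_ge0.
Qed.

Lemma enorm_le_normr v : enorm v <= n%:R * `|v|.
Proof.
apply: le_trans (enorm_le_sum v) _.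
rewrite -[X in X%:R]card_ord -sumr_const mulr_suml; apply: ler_sum => i _.
rewrite mul1r [leRHS]/Num.norm/= mx_normrE.
exact: (le_bigmax _ (fun ij : 'I_1 * 'I_n => `|v ij.1 ij.2|) (0, i)).
Qed.

Lemma normr_le_enorm v : `|v| <= enorm v.
Proof.
rewrite [leLHS]/Num.norm/= mx_normrE; apply: bigmax_le; first exact: enorm_ge0.
by move=> [i j] _ /=; rewrite ord1; exact: norm_coord_le_enorm.
Qed.

End EuclideanNorm.

(** * Epsilon-delta forms of derivatives and continuity *)

Section EpsilonDelta.
Variable R : realType.

(** The difference quotient is multiplied out by [s - t], so that first-order errors can be added
    and [s = t] is allowed. *)
Lemma is_derive1_normP (V : normedModType R) (x : R -> V) (t : R) (v : V) :
  is_derive t 1 x v <->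
  forall e, 0 < e -> exists2 d : R, 0 < d &
    forall s, `|s - t| < d -> `|x s - x t - (s - t) *: v| <= e * `|s - t|.
Proof.
split.
  move=> xv e e0.
  have [+ dxv] := xv; rewrite /derivable; move=> /cvgP.
  rewrite -/(derive x t 1) dxv => /cvgrPdist_le /(_ _ e0).
  rewrite near_withinE => /nbhs_ballP[d /= d0 xd].
  exists d => // s sd; have [->|st] := eqVneq s t.
    by rewrite !subrr scale0r subr0 !normr0 mulr0.
  have st0 : s - t != 0 by rewrite subr_eq0.
  have := xd (s - t); rewrite /ball/= sub0r normrN => /(_ sd st0).
  rewrite /GRing.scale/= mulr1 subrK => h.
  have -> : x s - x t - (s - t) *: v =
      - ((s - t) *: (v - (s - t)^-1 *: (x s - x t))).
    by rewrite scalerBr scalerA divff// scale1r opprB.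
  by rewrite normrN normrZ mulrC ler_wpM2r.
move=> xv.
have cv : (fun h => h^-1 *: (x (h *: 1 + t) - x t)) @ 0^' --> v.
  apply/cvgrPdist_le => e e0; have [d d0 xd] := xv _ e0.
  rewrite near_withinE; apply/nbhs_ballP; exists d => //= h.
  rewrite /ball/= sub0r normrN => hd h0; have := xd (h + t).
  rewrite addrK => /(_ hd) hx.
  have -> : v - h^-1 *: (x (h *: 1 + t) - x t) =
      - (h^-1 *: (x (h + t) - x t - h *: v)).
    by rewrite [h *: 1]mulr1 [in RHS]scalerBr scalerA mulVf// scale1r opprB.
  by rewrite normrN normrZ normfV mulrC ler_pdivrMr ?normr_gt0.
apply: DeriveDef; first by apply/cvg_ex; exists v.
exact: cvg_lim.
Qed.

Lemma is_derive1_enormP n (x : R -> 'rV[R]_n) (t : R) (v : 'rV[R]_n) :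
  is_derive t 1 x v <->
  forall e, 0 < e -> exists2 d : R, 0 < d &
    forall s, `|s - t| < d -> enorm (x s - x t - (s - t) *: v) <= e * `|s - t|.
Proof.
rewrite is_derive1_normP; split=> xv e e0; last first.
  have [d d0 xd] := xv _ e0; exists d => // s /xd.
  exact: le_trans (normr_le_enorm _).
(* The comparison constant between the norms is [n]; [n.+1] is a nonzero divisor for every [n]. *)
have e0' : 0 < e / n.+1%:R by rewrite divr_gt0.
have [d d0 xd] := xv _ e0'; exists d => // s /xd h.
apply: le_trans (enorm_le_normr _) _.
apply: le_trans (ler_wpM2l _ h) _ => //.
rewrite mulrA ler_wpM2r// mulrCA ger_pMr// ler_pdivrMr// mul1r.
by rewrite ler_nat.
Qed.

(** Only points of [[a, b]] are tested, which makes restriction, translation and gluing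
    elementary. *)
Definition econtinuous n (x : R -> 'rV[R]_n) (a b : R) :=
  forall t, a <= t <= b -> forall e, 0 < e -> exists2 d : R, 0 < d &
    forall s, a <= s <= b -> `|s - t| < d -> enorm (x s - x t) < e.

Lemma econtinuousP n (x : R -> 'rV[R]_n) (a b : R) :
  {within `[a, b], continuous x} <-> econtinuous x a b.
Proof.
rewrite subspace_continuousP; split=> xA t At.
  move=> e e0; have e0' : 0 < e / n.+1%:R by rewrite divr_gt0.
  have /cvgrPdist_lt /(_ _ e0') := xA _ At.
  rewrite near_withinE => /nbhs_ballP[d /= d0 xd]; exists d => // s As sd.
  rewrite enormBC; apply: le_lt_trans (enorm_le_normr _) _.
  have := xd s; rewrite /ball/= distrC => /(_ sd As) h.
  apply: (@le_lt_trans _ _ (n.+1%:R * `|x t - x s|)).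
    by rewrite ler_wpM2r// ler_nat.
  by rewrite mulrC -ltr_pdivlMr.
apply/cvgrPdist_lt => e e0; have [d d0 xd] := xA _ At _ e0.
rewrite near_withinE; apply/nbhs_ballP; exists d => //= s.
rewrite /ball/= distrC => sd As; rewrite distrC.
exact: le_lt_trans (normr_le_enorm _) (xd _ As sd).
Qed.

End EpsilonDelta.

(** * Almost-everywhere statements and translation invariance of Lebesgue measure *)

Section Translation.
Variable R : realType.
Notation leb := (@lebesgue_measure R).

Lemma ae_le (P Q : R -> Prop) : (forall t, P t -> Q t) ->
  {ae leb, forall t, P t} -> {ae leb, forall t, Q t}.
Proof. by move=> PQ; apply: negligibleS => t /= nQ /PQ. Qed.

Lemma ae_and (P Q : R -> Prop) : {ae leb, forall t, P t} ->
  {ae leb, forall t, Q t} -> {ae leb, forall t, P t /\ Q t}.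
Proof.
move=> aeP aeQ; apply: negligibleS (negligibleU aeP aeQ) => t /= /not_andP.
by case; [left|right].
Qed.

Lemma ae_all (P : nat -> R -> Prop) : (forall k, {ae leb, forall t, P k t}) ->
  {ae leb, forall t, forall k, P k t}.
Proof.
move=> aeP; apply: negligibleS (negligible_bigcup aeP) => t /=.
by move=> /existsNP[k nP]; exists k.
Qed.

Lemma ae_notin_countable (A : set R) : countable A ->
  {ae leb, forall t, ~ A t}.
Proof.
move=> cA; apply: (@negligibleS _ _ _ leb A); first by move=> t /= /contrapT.
apply/negligibleP; last exact: countable_lebesgue_measure0.
exact: countable_measurable.
Qed.

Lemma measurable_fun_shift (c : R) :
  measurable_fun setT (fun t : measurableTypeR R => c + t : measurableTypeR R).
Proof. by apply: measurable_funD => //; exact: measurable_cst. Qed.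

(** The pushforward of the measure by the translation has the same value on half-open intervals, and
    these values determine it. *)
Lemma lebesgue_measure_shift (c : R) (A : set (measurableTypeR R)) :
  measurable A -> leb [set t | A (c + t)] = leb A.
Proof.
move=> mA; pose g := fun t : measurableTypeR R => c + t : measurableTypeR R.
pose mg : {mfun measurableTypeR R >-> measurableTypeR R} :=
  mfun_Sub (mem_set (measurable_fun_shift c : measurable_fun setT g)).
apply/esym.
apply: (@lebesgue_measure_unique R (pushforward leb mg)) => // _ [[a b] _ <-].
have gab : g @^-1` `]a, b]%classic = `]a - c, b - c]%classic.
  by apply/seteqP; split=> t; rewrite /g/= !in_itv/= => /andP[]; lra.
have {gab}: leb `]a, b]%classic = leb (g @^-1` `]a, b]%classic).
  rewrite gab !lebesgue_measure_itv/= !lte_fin ltrD2r; case: ifP => // _.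
  by rewrite -!EFinB; congr EFin; ring.
exact.
Qed.

Lemma negligible_shift (c : R) (N : set R) :
  leb.-negligible N -> leb.-negligible [set t | N (c + t)].
Proof.
move=> [M [mM M0 NM]]; exists [set t | M (c + t)]; split.
- by have := measurable_fun_shift c measurableT mM; rewrite setTI.
- by rewrite lebesgue_measure_shift.
- by move=> t /NM.
Qed.

Lemma ae_shift (c : R) (P : R -> Prop) :
  {ae leb, forall t, P t} -> {ae leb, forall t, P (c + t)}.
Proof. exact: negligible_shift. Qed.

(** The generators of the completed sigma-algebra are unions of a Borel set and a negligible set;
    translation preserves both kinds. *)
Lemma measurable_fun_lebesgue_shift (c : R) :
  measurable_fun setT (fun t : lebesgueTypeR R => c + t : lebesgueTypeR R).
Proof.
apply: (@measurability _ _ (lebesgueTypeR R) (lebesgueTypeR R) setT _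
  (completed_algebra_gen leb)) => //.
move=> _ [_ [A mA] [N negN <-] <-]; rewrite setTI.
apply: sub_sigma_algebra; exists [set t | A (c + t)].
  by have := measurable_fun_shift c measurableT mA; rewrite setTI.
by exists [set t | N (c + t)] => //; exact: negligible_shift.
Qed.

End Translation.

(** * Essential supremum norm of inputs, and inputs shifted in time *)

Section Inputs.
Variables (R : realType) (m : nat).
Notation leb := (@lebesgue_measure R).
Implicit Types (u : R -> 'rV[R]_m) (c s t : R).

Lemma lebesgue_measureT_gt0 : (0 < leb setT)%E.
Proof. by rewrite -set_itvNyy lebesgue_measure_itv/= addye. Qed.

Lemma ess_norm_ge0 u t : (0 <= ess_norm u t)%E.
Proof.
apply: ess_sup_gee; first exact: lebesgue_measureT_gt0.
by apply: aeW => s; rewrite lee_fin; case: ifP => // _; exact: enorm_ge0.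
Qed.

Lemma le_ess_norm u s t : s <= t -> (ess_norm u s <= ess_norm u t)%E.
Proof.
move=> st; apply: le_ess_sup; apply: aeW => r; rewrite lee_fin.
case: ifP => [/andP[r0 rs]|_]; first by rewrite r0 (le_trans rs st).
by case: ifP => // _; exact: enorm_ge0.
Qed.

(** Only an inequality, since the shifted signal forgets the values of [u] on [[0, c[]. *)
Lemma ess_norm_shift u c t :
  0 <= c -> (ess_norm (fun s => u (c + s)%R) t <= ess_norm u (c + t)%R)%E.
Proof.
move=> c0; apply/ess_supP.
have := ae_shift c (ess_sup_ge leb
  (fun s => (if (0 <= s <= c + t)%R then enorm (u s) else 0)%:E)).
apply: ae_le => s; apply: le_trans; rewrite lee_fin.
case: ifP => [/andP[s0 st]|_]; first by rewrite addr_ge0//= lerD2l st.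
by case: ifP => // _; exact: enorm_ge0.
Qed.

Lemma input_ess_normE u t : input_space u -> 0 <= t ->
  ess_norm u t = (fine (ess_norm u t))%:E.
Proof.
move=> [_ uoo] t0; rewrite fineK// ge0_fin_numE; first exact: uoo.
exact: ess_norm_ge0.
Qed.

Lemma fine_ess_norm_ge0 u t : 0 <= fine (ess_norm u t).
Proof. by rewrite fine_ge0// ess_norm_ge0. Qed.

Lemma le_fine_ess_norm u s t : input_space u -> 0 <= s -> s <= t ->
  fine (ess_norm u s) <= fine (ess_norm u t).
Proof.
move=> uU s0 st; rewrite -lee_fin -!input_ess_normE// ?(le_trans s0)//.
exact: le_ess_norm.
Qed.

Lemma ae_le_ess_norm u t : input_space u -> 0 <= t ->
  {ae leb, forall s, 0 <= s <= t -> enorm (u s) <= fine (ess_norm u t)}.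
Proof.
move=> uU t0; have := ess_sup_ge leb
  (fun s => (if (0 <= s <= t)%R then enorm (u s) else 0)%:E).
rewrite -/(ess_norm u t) (input_ess_normE uU t0).
by apply: ae_le => s + st; rewrite st lee_fin.
Qed.

Lemma input_space_shift u c : 0 <= c -> input_space u ->
  input_space (fun s => u (c + s)).
Proof.
move=> c0 [mu uoo]; split; last first.
  move=> t t0; apply: le_lt_trans (ess_norm_shift u t c0) _.
  by rewrite uoo// addr_ge0.
move=> i; have m0oo : measurable (`[0, +oo[ : set (lebesgueTypeR R)).
  apply: sub_sigma_algebra; exists `[0, +oo[%classic.
    exact: measurable_itv.
  by exists set0; [exact: negligible_set0|rewrite setU0].
move=> _ Y mY.
have mP := mu i m0oo Y mY.
have := measurable_fun_lebesgue_shift c measurableT mP; rewrite setTI => mQ.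
(* Measurability of [u] is known only on [[0, +oo[]: the preimage is taken there, translated, and
   cut back to [[0, +oo[]. *)
rewrite (_ : _ `&` _ = `[0, +oo[%classic `&` (fun t => c + t) @^-1`
   (`[0, +oo[%classic `&` (fun t => u t 0 i) @^-1` Y)); first exact: measurableI.
apply/seteqP; split=> t /=; rewrite !in_itv/= !andbT.
  by move=> [t0 Yt]; split=> //; split=> //; rewrite addr_ge0.
by move=> [t0 []].
Qed.

Lemma fine_ess_norm_shift u c t : input_space u -> 0 <= c -> 0 <= t ->
  fine (ess_norm (fun s => u (c + s)) t) <= fine (ess_norm u (c + t)).
Proof.
move=> uU c0 t0; rewrite -lee_fin -!input_ess_normE ?addr_ge0//.
  exact: ess_norm_shift.
exact: input_space_shift.
Qed.

End Inputs.

(** * Compactness of intervals; continuous functions on them *)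

Section Intervals.
Variable R : realType.

(* Cousin's lemma. *)
Lemma interval_induction (P : R -> R -> Prop) (a b : R) : a <= b ->
  (forall r s t, a <= r -> r <= s -> s <= t -> t <= b ->
     P r s -> P s t -> P r t) ->
  (forall r, a <= r <= b -> exists2 d, 0 < d & forall s t,
     a <= s -> s <= r -> r <= t -> t <= b -> t - s < d -> P s t) ->
  P a b.
Proof.
move=> ab addP locP; pose S := [set t | a <= t <= b /\ P a t].
have Sa : S a.
  split; first by rewrite lexx.
  have [|d d0 Pd] := locP a; first by rewrite lexx.
  by apply: Pd => //; rewrite subrr.
have supS : has_sup S by split; [exists a|exists b => t [/andP[]]].
have ac : a <= sup S by apply: ub_le_sup => //; case: supS.
have cb : sup S <= b by apply: ge_sup; [exists a|move=> t [/andP[]]].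
have [|d d0 Pd] := locP (sup S); first by rewrite ac.
have [s [/andP[as_ sb] Ps] ds] := sup_adherent d0 supS.
have sc : s <= sup S.
  by apply: ub_le_sup; [case: supS|split; rewrite ?as_].
have Pc : P a (sup S).
  by apply: addP Ps _ => //; apply: Pd => //; lra.
(* A point past the supremum, truncated at [b]. It still belongs to [S], hence does not exceed
   [sup S], so the truncation took place. *)
pose t := Num.min b (sup S + d / 2).
have ct : sup S <= t by rewrite le_min cb lerDl divr_ge0// ltW.
have tb : t <= b by rewrite ge_min lexx.
have td : t <= sup S + d / 2 by rewrite ge_min lexx orbT.
have Pt : P a t by apply: addP Pc _ => //; apply: Pd => //; lra.
have tc : t <= sup S.
  by apply: ub_le_sup; [case: supS|split; rewrite ?tb ?(le_trans ac)].
suff <- : t = b by [].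
move: tc; rewrite /t; case: (leP b) => // _; lra.
Qed.

Variable n : nat.
Implicit Types (x y : R -> 'rV[R]_n) (a b c : R).

(** Bounds on adjacent intervals combine, and near [r] the bound [1 + enorm (x r)] holds, so
    [interval_induction] applies. *)
Lemma econtinuous_bounded x a b : a <= b -> econtinuous x a b ->
  exists K, forall t, a <= t <= b -> enorm (x t) <= K.
Proof.
move=> ab xab; apply: (@interval_induction (fun s t =>
  exists K, forall r, s <= r <= t -> enorm (x r) <= K)) => //.
  move=> r s t ar rs st tb [K1 h1] [K2 h2]; exists (Num.max K1 K2) => q /andP[rq qt].
  rewrite le_max; have [qs|sq] := leP q s.
    by rewrite h1// rq.
  by rewrite h2 ?orbT// (ltW sq).
move=> r rab; have [d d0 xd] := xab r rab 1 ltr01.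
exists d => // s t as_ sr rt tb std; exists (1 + enorm (x r)) => q /andP[sq qt].
rewrite -[x q](subrK (x r)); apply: le_trans (ler_enormD _ _) _.
rewrite lerD2r ltW// xd//; first by rewrite (le_trans as_)//= (le_trans qt).
by rewrite ltr_norml; apply/andP; split; lra.
Qed.

Lemma econtinuous_sub x a b c d : a <= c -> d <= b ->
  econtinuous x a b -> econtinuous x c d.
Proof.
move=> ac db xab t /andP[ct td] e e0.
have [|r r0 xr] := xab t _ e e0.
  by rewrite (le_trans ac)//= (le_trans td).
exists r => // s /andP[cs sd]; apply: xr.
by rewrite (le_trans ac)//= (le_trans sd).
Qed.

Lemma econtinuous_shift x a b c : econtinuous x a b ->
  econtinuous (fun t => x (c + t)) (a - c) (b - c).
Proof.
move=> xab t /andP[at_ tb] e e0.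
have [|r r0 xr] := xab (c + t) _ e e0.
  by apply/andP; split; lra.
exists r => // s /andP[cs sd] st; apply: xr; first by apply/andP; split; lra.
by rewrite (_ : c + s - (c + t) = s - t)//; ring.
Qed.

Lemma eq_econtinuous x y a b : (forall t, a <= t <= b -> x t = y t) ->
  econtinuous x a b -> econtinuous y a b.
Proof.
move=> xy xab t tab e e0; have [d d0 xd] := xab t tab e e0.
by exists d => // s sab /(xd s sab); rewrite !xy.
Qed.

Lemma econtinuousB x y a b : econtinuous x a b -> econtinuous y a b ->
  econtinuous (x \- y) a b.
Proof.
move=> xab yab t tab e e0.
have [d1 d10 xd] := xab t tab _ (divr_gt0 e0 (ltr0Sn R 1)).
have [d2 d20 yd] := yab t tab _ (divr_gt0 e0 (ltr0Sn R 1)).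
exists (Num.min d1 d2); first by rewrite lt_min d10.
move=> s sab; rewrite lt_min => /andP[/(xd s sab) h1 /(yd s sab) h2].
rewrite [X in enorm X](_ : _ = (x s - x t) - (y s - y t)); last first.
  by rewrite /= !opprB addrACA [RHS]addrACA [- y s + _]addrC.
apply: le_lt_trans (ler_enormB _ _) _; rewrite [e in _ < e](splitr e).
exact: ltrD.
Qed.

Lemma econtinuous_cat x a b c : a <= b -> b <= c ->
  econtinuous x a b -> econtinuous x b c -> econtinuous x a c.
Proof.
move=> ab bc xab xbc t /andP[at_ tc] e e0.
have [tb|bt] := ltP t b.
  have [|d d0 xd] := xab t _ e e0; first by rewrite at_ ltW.
  (* The radius [b - t] keeps [s] on the same side of [b] as [t]. *)
  exists (Num.min d (b - t)); first by rewrite lt_min d0 subr_gt0.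
  move=> s /andP[as_ sc]; rewrite lt_min => /andP[sd stb]; apply: xd => //.
  by rewrite as_; move: stb; rewrite ltr_norml => /andP[]; lra.
have [{}bt|tb] := ltP b t.
  have [|d d0 xd] := xbc t _ e e0; first by rewrite tc ltW.
  exists (Num.min d (t - b)); first by rewrite lt_min d0 subr_gt0.
  move=> s /andP[as_ sc]; rewrite lt_min => /andP[sd stb]; apply: xd => //.
  by rewrite sc andbT; move: stb; rewrite ltr_norml => /andP[]; lra.
have {bt tb} -> : t = b by apply/eqP; rewrite eq_le tb.
have [|d1 d10 xd1] := xab b _ e e0; first by rewrite ab lexx.
have [|d2 d20 xd2] := xbc b _ e e0; first by rewrite bc lexx.
exists (Num.min d1 d2); first by rewrite lt_min d10.
move=> s /andP[as_ sc]; rewrite lt_min => /andP[sd1 sd2].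
by have [sb|/ltW bs] := leP s b; [apply: xd1; rewrite ?as_|apply: xd2; rewrite ?bs].
Qed.

End Intervals.

(** * The norm of histories *)

Section HistoryNorm.
Variables (R : realType) (Delta : R) (n : nat).
Hypothesis hDelta : 0 <= Delta.
Implicit Types (phi psi x : R -> 'rV[R]_n).

Lemma hist_spaceP phi : hist_space Delta phi <-> econtinuous phi (- Delta) 0.
Proof. exact: econtinuousP. Qed.

(** A real [sup] dominates its set only if the set is bounded; continuity on the compact interval
    provides this. *)
Lemma enorm_le_hist_norm phi tau : hist_space Delta phi ->
  - Delta <= tau <= 0 -> enorm (phi tau) <= hist_norm Delta phi.
Proof.
move=> /hist_spaceP phic tauD.
have D0 : - Delta <= 0 by rewrite oppr_le0.
have [K hK] := econtinuous_bounded D0 phic.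
apply: ub_le_sup; last by exists tau.
by exists K => _ [t tD <-]; exact: hK.
Qed.

Lemma hist_norm_le phi K : (forall tau, - Delta <= tau <= 0 ->
  enorm (phi tau) <= K) -> hist_norm Delta phi <= K.
Proof.
move=> phiK; apply: ge_sup.
  by exists (enorm (phi 0)), 0 => //=; rewrite in_itv/= oppr_le0 hDelta lexx.
by move=> _ [tau tauD <-]; exact: phiK.
Qed.

Lemma hist_norm_ge0 phi : hist_space Delta phi -> 0 <= hist_norm Delta phi.
Proof.
move=> phic; apply: le_trans (enorm_ge0 (phi 0)) _.
by rewrite enorm_le_hist_norm// oppr_le0 hDelta lexx.
Qed.

Lemma hist_space_hist x t T : econtinuous x (- Delta) T -> 0 <= t <= T ->
  hist_space Delta (hist x t).
Proof.
move=> xc /andP[t0 tT]; apply/hist_spaceP.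
have := @econtinuous_shift _ _ _ _ _ t xc; apply: econtinuous_sub; lra.
Qed.

Lemma hist_spaceB phi psi : hist_space Delta phi -> hist_space Delta psi ->
  hist_space Delta (phi \- psi).
Proof.
by move=> /hist_spaceP ? /hist_spaceP ?; apply/hist_spaceP; exact: econtinuousB.
Qed.

End HistoryNorm.

(** * Stability properties of absolute continuity *)

Section AbsoluteContinuity.
Variables (R : realType) (n : nat).
Implicit Types (x y : R -> 'rV[R]_n) (a b c : R).

Lemma abs_continuous_econtinuous x a b :
  abs_continuous x a b -> econtinuous x a b.
Proof.
move=> xac t tab e e0; have [d d0 xd] := xac e e0; exists d => // s sab std.
have := @xd 1%N (fun=> Num.min s t) (fun=> Num.max s t).
rewrite !big_ord1 => h; suff : enorm (x (Num.max s t) - x (Num.min s t)) < e.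
  by have [_|//] := leP s t; rewrite (enormBC (x s) (x t)).
apply: h.
- move=> _; case/andP: sab => as_ sb; case/andP: tab => at_ tb.
  by rewrite le_min as_ at_ ge_max sb tb; split=> //; split=> //;
     have [|/ltW] := leP s t.
- by apply/trivIsetP => i j _ _; rewrite !ord1 eqxx.
- by move: std; rewrite ltr_norml => /andP[]; have [st|st] := leP s t; lra.
Qed.

Lemma abs_continuous_sub x a b c d : a <= c -> d <= b ->
  abs_continuous x a b -> abs_continuous x c d.
Proof.
move=> ac db xab e e0; have [r r0 xr] := xab e e0; exists r => // N s t st.
apply: xr => i; have [cs [sti td]] := st i.
by split; [exact: le_trans cs|split=> //; exact: le_trans db].
Qed.

Lemma eq_abs_continuous x y a b : (forall t, a <= t <= b -> x t = y t) ->
  abs_continuous x a b -> abs_continuous y a b.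
Proof.
move=> xy xab e e0; have [d d0 xd] := xab e e0; exists d => // N s t st tst std.
rewrite (eq_bigr (fun i => enorm (x (t i) - x (s i)))); first exact: xd.
move=> i _; have [as_ [sti tb]] := st i.
by rewrite !xy// ?as_ ?tb ?(le_trans as_)// (le_trans sti).
Qed.

Lemma abs_continuous_shift x a b c : abs_continuous x a b ->
  abs_continuous (fun t => x (t - c)) (a + c) (b + c).
Proof.
move=> xab e e0; have [d d0 xd] := xab e e0; exists d => // N s t st tst std.
apply: (xd N (fun i => s i - c) (fun i => t i - c)).
- by move=> i; have [as_ [sti tb]] := st i; split; [lra|split; lra].
- apply/trivIsetP => i j _ _ ij; apply/seteqP; split=> // r /=.
  rewrite !in_itv/= => -[/andP[h1 h2] /andP[h3 h4]].
  move/trivIsetP : tst => /(_ i j Logic.I Logic.I ij) /seteqP[+ _].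
  move=> /(_ (r + c)); apply; split; rewrite /= in_itv/=.
    by apply/andP; split; lra.
  by apply/andP; split; lra.
- rewrite (eq_bigr (fun i => t i - s i))// => i _; ring.
Qed.

Lemma abs_continuousD x y a b : abs_continuous x a b -> abs_continuous y a b ->
  abs_continuous (x \+ y) a b.
Proof.
move=> xab yab e e0.
have [d1 d10 xd] := xab _ (divr_gt0 e0 (ltr0Sn R 1)).
have [d2 d20 yd] := yab _ (divr_gt0 e0 (ltr0Sn R 1)).
exists (Num.min d1 d2); first by rewrite lt_min d10.
move=> N s t st tst; rewrite lt_min => /andP[sd1 sd2].
apply: (@le_lt_trans _ _ (\sum_(i < N) enorm (x (t i) - x (s i)) +
                          \sum_(i < N) enorm (y (t i) - y (s i)))).
  rewrite -big_split; apply: ler_sum => i _ /=.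
  by rewrite opprD addrACA ler_enormD.
by rewrite [e in _ < e](splitr e) ltrD ?xd ?yd.
Qed.

Lemma lipschitz_abs_continuous x a b K :
  (forall s t, a <= s -> s <= t -> t <= b ->
    enorm (x t - x s) <= K * (t - s)) ->
  abs_continuous x a b.
Proof.
(* The sign of [K] is arbitrary; the maximum with 1 is a positive divisor. *)
move=> xK e e0; have K0 : 0 < Num.max K 1 by rewrite lt_max ltr01 orbT.
exists (e / Num.max K 1); first by rewrite divr_gt0.
move=> N s t st _; rewrite ltr_pdivlMr// mulrC => /(le_lt_trans _); apply.
rewrite mulr_sumr; apply: ler_sum => i _; have [as_ [sti tb]] := st i.
apply: le_trans (xK _ _ as_ sti tb) _.
by rewrite ler_wpM2r ?subr_ge0// le_max lexx.
Qed.

Lemma abs_continuousN x a b : abs_continuous x a b ->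
  abs_continuous (fun t => - x t) a b.
Proof.
move=> xab e e0; have [d d0 xd] := xab e e0; exists d => // N s t st tst std.
rewrite (eq_bigr (fun i => enorm (x (t i) - x (s i)))); first exact: xd.
by move=> i _; rewrite -opprD enormN.
Qed.

Lemma abs_continuousB x y a b : abs_continuous x a b -> abs_continuous y a b ->
  abs_continuous (x \- y) a b.
Proof. by move=> xab /abs_continuousN; exact: abs_continuousD. Qed.

(** Every interval is cut at [b]: [lo] clips its ends to the left of [b] and [hi] to the right. Each
    clipped family consists of subintervals of the old one, hence stays disjoint, and has no larger
    total length. *)
Lemma abs_continuous_cat x a b c : a <= b -> b <= c ->
  abs_continuous x a b -> abs_continuous x b c -> abs_continuous x a c.
Proof.
move=> ab bc xab xbc e e0.
have [d1 d10 xd1] := xab _ (divr_gt0 e0 (ltr0Sn R 1)).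
have [d2 d20 xd2] := xbc _ (divr_gt0 e0 (ltr0Sn R 1)).
exists (Num.min d1 d2); first by rewrite lt_min d10.
move=> N s t st tst; rewrite lt_min => /andP[sd1 sd2].
pose lo (f : 'I_N -> R) i := Num.min (f i) b.
pose hi (f : 'I_N -> R) i := Num.max (f i) b.
have split_sum i : enorm (x (t i) - x (s i)) <=
    enorm (x (lo t i) - x (lo s i)) + enorm (x (hi t i) - x (hi s i)).
  have [_ [sti _]] := st i; rewrite /lo /hi.
  have [ti|ti] := leP (t i) b.
    by rewrite (min_l (le_trans sti ti)) lerDl enorm_ge0.
  have [si|si] := leP (s i) b.
    by rewrite [leRHS]addrC; exact: (ler_enorm_distD (x b)).
  by rewrite lerDr enorm_ge0.
apply: (le_lt_trans (y := \sum_(i < N) (enorm (x (lo t i) - x (lo s i)) +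
                                        enorm (x (hi t i) - x (hi s i))))).
  by apply: ler_sum => i _; exact: split_sum.
rewrite big_split /= [e in _ < e](splitr e).
have trivI (f g : 'I_N -> R) : (forall i, `]f i, g i[ `<=` `]s i, t i[) ->
    trivIset setT (fun i => `]f i, g i[%classic).
  move=> fg; apply/trivIsetP => i j _ _ ij.
  move/trivIsetP : tst => /(_ i j Logic.I Logic.I ij).
  by apply: subsetI_eq0.
apply: ltrD; [apply: xd1|apply: xd2].
- move=> i; have [asi [sti tc]] := st i; rewrite /lo.
  split; [by rewrite le_min asi|split; [|by rewrite ge_min lexx orbT]].
  by rewrite le_min !ge_min lexx sti orbT.
- apply: trivI => i r; rewrite /= !in_itv/= /lo gt_min lt_min.
  move=> /andP[/orP[->/andP[->]//|br /andP[_ rb]]].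
  by move: (lt_trans br rb); rewrite ltxx.
- apply: le_lt_trans sd1; apply: ler_sum => i _; have [_ [sti _]] := st i.
  by rewrite /lo; have [?|?] := leP (s i) b; have [?|?] := leP (t i) b; lra.
- move=> i; have [asi [sti tc]] := st i; rewrite /hi.
  split; [by rewrite le_max lexx orbT|split; [|by rewrite ge_max tc bc]].
  by rewrite ge_max !le_max lexx sti orbT.
- apply: trivI => i r; rewrite /= !in_itv/= /hi gt_max lt_max.
  move=> /andP[/andP[-> br] /orP[->//|rb]].
  by move: (lt_trans br rb); rewrite ltxx.
- apply: le_lt_trans sd2; apply: ler_sum => i _; have [_ [sti _]] := st i.
  by rewrite /hi; have [?|?] := leP (s i) b; have [?|?] := leP (t i) b; lra.
Qed.

End AbsoluteContinuity.

(** * Chains of intervals and the mean value inequality *)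

Section MeanValue.
Variables (R : realType) (n : nat).
Notation leb := (@lebesgue_measure R).
Implicit Types (x : R -> 'rV[R]_n) (O : set R) (l : seq (R * R)).

(** An ordered list is used instead of the indexed disjoint families of [abs_continuous], so that
    chains over adjacent intervals concatenate. *)
Fixpoint chain O (a : R) l (b : R) : Prop :=
  if l is p :: l' then
    [/\ a <= p.1, p.1 <= p.2, `]p.1, p.2[ `<=` O & chain O p.2 l' b]
  else a <= b.

Lemma chain_cat O a b c l1 l2 :
  chain O a l1 b -> chain O b l2 c -> chain O a (l1 ++ l2) c.
Proof.
elim: l1 a => [|p l1 IH] a /=; last by move=> [? ? ? h1] h2; split=> //; exact: IH.
by case: l2 => [|q l2] /= ab; [exact: le_trans|case=> bq *; split=> //; exact: le_trans bq].
Qed.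

Lemma chain_bounds O a l b p : chain O a l b -> p \in l ->
  [/\ a <= p.1, p.1 <= p.2 & p.2 <= b].
Proof.
elim: l a => // q l IH a /= [aq qq _ ql].
rewrite in_cons => /orP[/eqP->|pl]; last first.
  by have [? ? ?] := IH _ ql pl; split=> //; lra.
split=> //; elim: l {IH aq qq} q.2 ql => //= r l IH c [? ? _ /IH]; lra.
Qed.

Lemma chain_sorted O a l b i j : chain O a l b -> (i < j < size l)%N ->
  (nth (0, 0) l i).2 <= (nth (0, 0) l j).1.
Proof.
elim: l a i j => [|p l IH] a i j /=; first by rewrite ltn0 andbF.
move=> [_ _ _ ql]; case: j => // j; case: i => [|i] /=; rewrite ltnS => ij.
  by have [] := chain_bounds ql (mem_nth (0, 0) ij).
by apply: IH ql _; rewrite -ltnS.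
Qed.

(** Cutting [O] at [a] makes the induction work: the first interval and the part of [O] beyond its
    right end are disjoint subsets of the part beyond [a]. *)
Lemma chain_measure O a l b : measurable (O : set (measurableTypeR R)) ->
  chain O a l b ->
  ((\sum_(p <- l) (p.2 - p.1))%:E <= leb (O `&` `]a, +oo[))%E.
Proof.
move=> mO; elim: l a => [|p l IH] a /=.
  by rewrite big_nil => _; exact: measure_ge0.
move=> [ap pp pO /IH h]; rewrite big_cons EFinD.
have mOi c : measurable (O `&` `]c, +oo[ : set (measurableTypeR R)).
  by apply: measurableI => //; exact: measurable_itv.
have -> : (p.2 - p.1)%:E = leb `]p.1, p.2[%classic.
  rewrite lebesgue_measure_itv/= lte_fin EFinB; case: ltP => // pp'.
  by have -> : p.1 = p.2 by [apply/eqP; rewrite eq_le pp]; rewrite subee.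
apply: le_trans (leeD2l _ h) _.
rewrite -measureU//; last first.
  apply/seteqP; split=> // t /= [] + [_].
  by rewrite !in_itv/= andbT => /andP[_] /lt_trans h1 /h1; rewrite ltxx.
apply: le_measure; rewrite ?inE//.
  by apply: measurableU => //; exact: measurable_itv.
move=> t /= [tp|[Ot]].
  split; first exact: pO.
  by move: tp; rewrite !in_itv/= andbT => /andP[+ _]; exact: le_lt_trans.
rewrite !in_itv/= !andbT => pt; split=> //.
by apply: le_lt_trans pt; exact: le_trans pp.
Qed.

(** The order of the list makes its intervals pairwise disjoint. The number [d] is chosen before
    [O], so [O] may depend on it. *)
Lemma abs_continuous_chain x a b : abs_continuous x a b ->
  forall e, 0 < e -> exists2 d : R, 0 < d & forall O l, chain O a l b ->
    \sum_(p <- l) (p.2 - p.1) < d ->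
    \sum_(p <- l) enorm (x p.2 - x p.1) < e.
Proof.
move=> xac e e0; have [d d0 xd] := xac e e0; exists d => // O l ch.
rewrite !(big_nth (0, 0)) !big_mkord => ld; apply: xd => //.
  move=> i; have [? ? ?] := chain_bounds ch (mem_nth (0, 0) (ltn_ord i)).
  by [].
have lt_disj (i j : 'I_(size l)) : (i < j)%N ->
    `](nth (0, 0) l i).1, (nth (0, 0) l i).2[%classic `&`
    `](nth (0, 0) l j).1, (nth (0, 0) l j).2[%classic = set0.
  move=> ij; have := @chain_sorted _ _ _ _ i j ch; rewrite ij ltn_ord => /(_ isT) h.
  apply/seteqP; split=> // t /=; rewrite !in_itv/= => -[/andP[_ h1] /andP[h2 _]].
  by move: (lt_trans h1 (le_lt_trans h h2)); rewrite ltxx.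
apply/trivIsetP => i j _ _; rewrite neq_ltn => /orP[/lt_disj//|/lt_disj].
by rewrite setIC.
Qed.

(* Cover [a, b] by intervals satisfying the local bound and intervals contained
   in an open neighbourhood of small measure of the exceptional null set;
   absolute continuity makes the contribution of the latter small. *)
Lemma abs_continuous_increment_le x (g : R -> R) a b : a <= b ->
  abs_continuous x a b ->
  (forall s t, a <= s -> s <= t -> t <= b -> g s <= g t) ->
  {ae leb, forall r, a < r < b -> forall e, 0 < e ->
     exists2 d : R, 0 < d & forall s t,
       s <= r -> r <= t -> t - s < d ->
       enorm (x t - x s) <= g t - g s + e * (t - s)} ->
  enorm (x b - x a) <= g b - g a.
Proof.
move=> ab xac g_mono [M [mM M0 NM]].
apply/ler_addgt0Pr => e e0.
have ba1 : 0 < b - a + 1 by lra.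
(* Half of [e] is spread over the length of [[a, b]], the other half is kept for the chain; the
   [+ 1] covers [a = b]. *)
pose e1 := e / 2 / (b - a + 1); have e10 : 0 < e1 by rewrite !divr_gt0.
have [d d0 xd] := abs_continuous_chain xac (divr_gt0 e0 (ltr0Sn R 1)).
(* The local bound is assumed only for [a < r < b], so the endpoints join the exceptional set. *)
pose M' := M `|` [set a; b].
have mab : measurable ([set a; b] : set (measurableTypeR R)).
  by apply: measurableU; exact: measurable_set1.
have mM' : measurable (M' : set (measurableTypeR R)) by exact: measurableU.
have M'0 : leb M' = 0%E.
  apply: (measure_negligible mM'); apply: negligibleU.
    by apply/negligibleP.
  apply/negligibleP => //; apply/countable_lebesgue_measure0.
  by apply: finite_set_countable; rewrite finite_setU; split; exact: finite_set1.
have [|O [openO MO Od]] := lebesgue_regularity_outer mM' _ d0.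
  apply: (@le_lt_trans _ _ 0%E); last exact: ltry.
  by rewrite le_eqVlt; apply/orP; left; apply/eqP.
have mO : measurable (O : set (measurableTypeR R)) by exact: open_measurable.
(* Outer regularity controls [O] minus [M']; as [M'] is null, it controls [O] itself. *)
have {}Od : (leb O < d%:E)%E.
  apply: le_lt_trans Od.
  apply: (@le_trans _ _ (leb (O `\` M') + leb M')%E).
    have := measureU2 leb (measurableD mO mM') mM'.
    by rewrite setUC (setDUK MO).
  rewrite le_eqVlt; apply/orP; left; apply/eqP.
  transitivity (leb (O `\` M') + 0)%E; last exact: adde0.
  by congr (_ + _)%E; exact: M'0.
pose P s t := exists2 l, chain O s l t & enorm (x t - x s) <=
  g t - g s + e1 * (t - s) + \sum_(p <- l) enorm (x p.2 - x p.1).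
suff [l ch h] : P a b.
  have ld : \sum_(p <- l) (p.2 - p.1) < d.
    rewrite -lte_fin; apply: le_lt_trans Od.
    apply: le_trans (chain_measure mO ch) _; apply: le_measure; rewrite ?inE//.
    by apply: measurableI => //; exact: measurable_itv.
  have /ltW h2 := xd _ _ ch ld; apply: le_trans h _.
  rewrite -addrA lerD2l [leRHS](splitr e) lerD//.
  by rewrite /e1 mulrAC ler_pdivrMr// ler_wpM2l// ?divr_ge0 ?(ltW e0)//; lra.
apply: interval_induction => // [r s t ar rs st tb [l1 c1 h1] [l2 c2 h2]|r].
  exists (l1 ++ l2); first exact: chain_cat c2.
  rewrite big_cat/=; have := ler_enorm_distD (x s) (x t) (x r); lra.
(* Around a point of [O] the whole small interval is put in the chain; around any other point the
   local bound works with an empty chain. *)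
move=> /andP[ar rb]; have [Or|nOr] := pselect (O r).
  have /nbhs_ballP[c /= c0 Oc] := open_nbhs_nbhs (conj openO Or).
  exists c => // s t as_ sr rt tb tsc; exists [:: (s, t)].
    split=> //=; first exact: le_trans rt.
    move=> q /=; rewrite in_itv/= => /andP[sq qt]; apply: Oc.
    by rewrite /ball/= ltr_norml; apply/andP; split; lra.
  rewrite big_seq1/= lerDr addr_ge0// ?subr_ge0 ?g_mono ?(le_trans sr)//.
  by rewrite mulr_ge0 ?subr_ge0 ?(le_trans sr)// ltW.
have nM : ~ M r by move=> Mr; apply/nOr/MO; left.
have rab : a < r < b.
  rewrite !lt_neqAle ar rb !andbT; apply/andP; split; apply/eqP => E.
    by apply/nOr/MO; right; left.
  by apply/nOr/MO; right; right.
have := contra_not (NM r) nM; move=> /contrapT /(_ rab _ e10) [c c0 h].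
exists c => // s t as_ sr rt tb tsc; exists [::]; first exact: le_trans rt.
by rewrite big_nil addr0 h.
Qed.

(** As [r] lies between [s] and [t], the distances [r - s] and [t - r] sum to [t - s], and so the
    first-order errors at [s] and [t] add up to a multiple of [t - s]. Half of [e] pays for [x],
    half for [g]. *)
Lemma is_derive_straddle x (g : R -> R) (r c : R) (v : 'rV[R]_n) :
  is_derive r 1 x v -> is_derive r 1 g c -> enorm v <= c ->
  forall e, 0 < e -> exists2 d : R, 0 < d & forall s t,
    s <= r -> r <= t -> t - s < d ->
    enorm (x t - x s) <= g t - g s + e * (t - s).
Proof.
move=> /is_derive1_enormP xv /is_derive1_normP gc vc e e0.
have e20 : 0 < e / 2 by rewrite divr_gt0.
have [d1 d10 xd] := xv _ e20; have [d2 d20 gd] := gc _ e20.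
exists (Num.min d1 d2); first by rewrite lt_min d10.
move=> s t sr rt; rewrite lt_min => /andP[td1 td2].
have rs_ : `|s - r| = r - s by rewrite ler0_norm ?subr_le0// opprB.
have tr_ : `|t - r| = t - r by rewrite ger0_norm ?subr_ge0.
have := xd s; have := xd t; have := gd s; have := gd t.
rewrite rs_ tr_.
move=> /(_ ltac:(lra)) g1 /(_ ltac:(lra)) g2 /(_ ltac:(lra)) x1 /(_ ltac:(lra)) x2.
move: g1 g2; rewrite !ler_norml /GRing.scale/= => /andP[g1 _] /andP[_ g2].
have -> : x t - x s = (x t - x r - (t - r) *: v) - (x s - x r - (s - r) *: v)
    + (t - s) *: v.
  have -> : (t - s) *: v = (t - r) *: v - (s - r) *: v.
    by rewrite -scalerBl; congr (_ *: _); ring.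
  by apply/rowP => i; rewrite !mxE; ring.
apply: le_trans (ler_enormD _ _) _; rewrite enormZ.
have ts : `|t - s| = t - s by rewrite ger0_norm// subr_ge0 (le_trans sr).
have := ler_enormB (x t - x r - (t - r) *: v) (x s - x r - (s - r) *: v).
have : `|t - s| * enorm v <= (t - s) * c.
  by rewrite ts ler_wpM2l// subr_ge0 (le_trans sr).
lra.
Qed.

Lemma abs_continuous_lipschitz x a b K : 0 <= K -> abs_continuous x a b ->
  {ae leb, forall r, a < r < b ->
     exists2 v, is_derive r 1 x v & enorm v <= K} ->
  forall s t, a <= s -> s <= t -> t <= b -> enorm (x t - x s) <= K * (t - s).
Proof.
move=> K0 xac xK s t as_ st tb; rewrite mulrBr.
apply: (@abs_continuous_increment_le x (fun t => K * t)) => //.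
- exact: abs_continuous_sub xac.
- by move=> *; rewrite ler_wpM2l.
apply: ae_le xK => r h /andP[sr rt]; have [|v xv vK] := h.
  by rewrite (le_lt_trans as_)//= (lt_le_trans rt).
apply: is_derive_straddle xv _ vK.
by apply: is_derive_eq; rewrite /GRing.scale/= mulr1.
Qed.

End MeanValue.

(** * A Gronwall inequality with delay *)

Section Gronwall.
Variables (R : realType) (n : nat) (Delta : R).
Hypothesis hDelta : 0 <= Delta.
Notation leb := (@lebesgue_measure R).

Lemma is_derive_expR_scale (C k r : R) :
  is_derive r 1 (fun t => C * expR (k * t)) (k * (C * expR (k * r))).
Proof.
by apply: is_derive_eq; rewrite /GRing.scale/= mulr1; ring.
Qed.

(* With weight e^(-2Lt), the derivative bound improves any weighted bound M
   on z into (3 `|z_0| + M) / 2. *)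
Lemma gronwall_delay (z : R -> 'rV[R]_n) (L T : R) : 0 < L -> 0 <= T ->
  econtinuous z (- Delta) T -> abs_continuous z 0 T ->
  {ae leb, forall r, 0 < r < T -> exists2 v, is_derive r 1 z v &
     enorm v <= L * hist_norm Delta (hist z r)} ->
  forall t, 0 <= t <= T ->
    enorm (z t) <= 3 * expR (2 * L * T) * hist_norm Delta z.
Proof.
move=> L0 T0 zc zac zL; pose B := hist_norm Delta z.
have z0 : hist_space Delta z.
  by apply/hist_spaceP; exact: econtinuous_sub zc.
have B0 : 0 <= B by exact: hist_norm_ge0.
have zB tau : - Delta <= tau <= 0 -> enorm (z tau) <= B.
  exact: enorm_le_hist_norm.
have D0 : - Delta <= 0 by rewrite oppr_le0.
have [K zK] := econtinuous_bounded (le_trans D0 T0) zc.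
pose w t := enorm (z t) * expR (- (2 * L * t)).
pose S := [set w t | t in `[0, T]%classic].
have S0 : S !=set0 by exists (w 0), 0 => //=; rewrite in_itv/= lexx.
have ubS : has_ubound S.
  exists K => q [t /=]; rewrite in_itv/= => /andP[t0 tT] <-.
  apply: le_trans (zK t _); last by rewrite tT (le_trans D0).
  by rewrite ler_piMr ?enorm_ge0// -expR0 ler_expR oppr_le0 !mulr_ge0// ltW.
pose M := sup S.
have wM t : 0 <= t <= T -> w t <= M.
  by move=> tT; apply: ub_le_sup => //; exists t.
have M0 : 0 <= M.
  by apply: le_trans (wM 0 _); rewrite ?lexx// mulr_ge0 ?enorm_ge0 ?expR_ge0.
have zM t : 0 <= t <= T -> enorm (z t) <= M * expR (2 * L * t).
  by move=> /wM; rewrite /w expRN ler_pdivrMr ?expR_gt0.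
have histM r : 0 <= r <= T ->
    hist_norm Delta (hist z r) <= (B + M) * expR (2 * L * r).
  move=> /andP[r0 rT]; apply: hist_norm_le => // tau /andP[tau1 tau2].
  have e1 : 1 <= expR (2 * L * r) by rewrite -expR0 ler_expR !mulr_ge0// ltW.
  (* Values before time 0 are bounded by [B], later ones by the weighted bound, whose exponential is
     increasing. *)
  rewrite /hist; have [rt|/ltW rt] := leP (r + tau) 0.
    apply: le_trans (zB _ _) _; first by rewrite rt andbT; lra.
    by rewrite -[leLHS]mulr1 ler_pM// lerDl.
  apply: le_trans (zM _ _) _; first by rewrite rt/=; lra.
  apply: ler_pM => //; rewrite ?expR_ge0// ?lerDr// ler_expR ler_wpM2l//.
    by rewrite mulr_ge0// ltW.
  by rewrite gerDl.
have MB : M <= 3 * B.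
  suff : M <= (3 * B + M) / 2 by lra.
  apply: ge_sup => // q [t /=]; rewrite in_itv/= => /andP[t0 tT] <-.
  (* The derivative of [g] is [L] times the bound of [histM]; the factor 1/2 comes from the weight
     exponent [2 * L]. *)
  pose g t := (B + M) / 2 * expR (2 * L * t).
  have zg : enorm (z t - z 0) <= g t - g 0.
    apply: abs_continuous_increment_le => //.
    - exact: abs_continuous_sub zac.
    - move=> r s r0 rs st; rewrite /g ler_wpM2l ?divr_ge0 ?addr_ge0//.
      by rewrite ler_expR ler_wpM2l// mulr_ge0// ltW.
    apply: ae_le zL => r h /andP[r0 rt]; have [|v zv vL] := h.
      by rewrite r0/=; lra.
    apply: is_derive_straddle zv (is_derive_expR_scale _ _ _) _.
    apply: le_trans vL _.
    have := histM r; rewrite (ltW r0) => /(_ ltac:(lra)) h2.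
    have := ler_wpM2l (ltW L0) h2; lra.
  have zt : enorm (z t) <= B + (g t - g 0).
    rewrite -[z t](subrK (z 0)); apply: le_trans (ler_enormD _ _) _.
    by rewrite addrC lerD// zB// D0 lexx.
  rewrite /w; apply: le_trans (ler_wpM2r (expR_ge0 _) zt) _.
  rewrite /g mulr0 expR0 expRN.
  have := expR_gt0 (2 * L * t); set E := expR _ => E0.
  have E1 : 1 <= E by rewrite /E -expR0 ler_expR !mulr_ge0// ltW.
  rewrite ler_pdivrMr//; nra.
move=> t tT; apply: le_trans (zM _ tT) _.
have e_le : expR (2 * L * t) <= expR (2 * L * T).
  by case/andP: tT => _ tT; rewrite ler_expR ler_wpM2l// mulr_ge0// ltW.
by rewrite [leRHS]mulrAC -/B ler_pM ?expR_ge0.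
Qed.

End Gronwall.

(** * Density of absolutely continuous histories, by piecewise affine interpolation *)

Section Density.
Variables (R : realType) (n : nat).
Notation leb := (@lebesgue_measure R).
Implicit Types (x y phi : R -> 'rV[R]_n).

Lemma is_derive1_local x y (t d : R) v : 0 < d ->
  (forall s, `|s - t| < d -> x s = y s) -> is_derive t 1 x v -> is_derive t 1 y v.
Proof.
move=> d0 xy /is_derive1_enormP xv; apply/is_derive1_enormP => e e0.
have [c c0 xc] := xv _ e0; exists (Num.min d c); first by rewrite lt_min d0.
move=> s; rewrite lt_min => /andP[sd sc]; rewrite -!xy//; first exact: xc.
by rewrite subrr normr0.
Qed.

Lemma is_derive1_itv x y (a b t : R) v : a < t < b ->
  (forall s, a < s < b -> x s = y s) -> is_derive t 1 x v -> is_derive t 1 y v.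
Proof.
move=> /andP[at_ tb] xy.
apply: (@is_derive1_local _ _ _ (Num.min (t - a) (b - t))).
  by rewrite lt_min !subr_gt0 at_.
move=> s; rewrite lt_min !ltr_norml => /andP[/andP[h1 h2] /andP[h3 h4]].
by apply: xy; apply/andP; split; lra.
Qed.

Lemma lipschitz_derive_le x (a b t K : R) v : a < t < b ->
  (forall p q, a <= p -> p <= q -> q <= b -> enorm (x q - x p) <= K * (q - p)) ->
  is_derive t 1 x v -> enorm v <= K.
Proof.
move=> /andP[at_ tb] xK /is_derive1_enormP xv.
apply/ler_addgt0Pr => e e0; have [d d0 xd] := xv _ e0.
(* Small enough for the first-order estimate at [t], with [t + h] still in [[a, b]]. *)
pose h := Num.min (d / 2) (b - t).
have h0 : 0 < h by rewrite lt_min divr_gt0// subr_gt0.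
have hd : h < d by rewrite gt_min; apply/orP; left; lra.
have hb : h <= b - t by rewrite ge_min lexx orbT.
have := xd (t + h); rewrite [t + h]addrC addrK gtr0_norm// => /(_ hd) h1.
have h2 : enorm (x (h + t) - x t) <= K * h.
  by rewrite -[X in K * X](addrK t); apply: xK; lra.
rewrite -(ler_pM2r h0) mulrC -[X in X * _]gtr0_norm// -enormZ.
have -> : h *: v = (x (h + t) - x t) - (x (h + t) - x t - h *: v).
  by rewrite opprB addrC subrK.
by apply: le_trans (ler_enormB _ _) _; rewrite mulrDl lerD.
Qed.

Definition pw_approx phi (e s t : R) (g : R -> 'rV[R]_n) (K : R) (F : seq R) :=
  [/\ forall r, s <= r <= t -> enorm (g r - phi r) <= e,
      g s = phi s /\ g t = phi t,
      forall p q, s <= p -> p <= q -> q <= t -> enorm (g q - g p) <= K * (q - p)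
    & forall r, s < r < t -> r \notin F -> exists v, is_derive r 1 g v].

(** The chord of [phi] serves: the error at [r] is at most the change of [phi] from [s] to [r] plus
    the displacement along the chord, each at most [e / 2]. *)
Lemma pw_approx_affine phi e s t : s <= t ->
  (forall r r', s <= r <= t -> s <= r' <= t ->
    enorm (phi r - phi r') <= e / 2) ->
  exists g K F, pw_approx phi e s t g K F.
Proof.
move=> st osc; pose w := (t - s)^-1 *: (phi t - phi s).
have hs : s <= s <= t by rewrite lexx.
have ht : s <= t <= t by rewrite lexx st.
exists (fun r => phi s + (r - s) *: w), (enorm w), [::].
split.
- move=> r /andP[sr rt]; rewrite addrAC; apply: le_trans (ler_enormD _ _) _.
  rewrite [leRHS](splitr e) lerD//; first by apply: osc => //; rewrite sr.
  rewrite /w scalerA enormZ; apply: le_trans (osc _ _ ht hs).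
  rewrite ler_piMl ?enorm_ge0// ger0_norm; last first.
    by rewrite divr_ge0// subr_ge0.
  have [->|ts] := eqVneq t s; first by rewrite subrr invr0 mulr0.
  by rewrite ler_pdivrMr ?mul1r ?lerD2r// subr_gt0 lt_neqAle eq_sym ts.
- split; first by rewrite subrr scale0r addr0.
  have [->|ts] := eqVneq t s; first by rewrite subrr scale0r addr0.
  by rewrite /w scalerA divff ?subr_eq0// scale1r addrC subrK.
- move=> p q _ pq _.
  have -> : phi s + (q - s) *: w - (phi s + (p - s) *: w) = (q - p) *: w.
    by rewrite opprD addrACA subrr add0r -scalerBl; congr (_ *: _); ring.
  by rewrite enormZ ger0_norm ?subr_ge0// mulrC.
- move=> r _ _; exists w; apply/is_derive1_enormP => d d0.
  exists 1 => // q _.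
  have -> : phi s + (q - s) *: w - (phi s + (r - s) *: w) = (q - r) *: w.
    by rewrite opprD addrACA subrr add0r -scalerBl; congr (_ *: _); ring.
  by rewrite subrr enorm0 mulr_ge0// ltW.
Qed.

(** Both pieces take the value [phi b] at [b], so increments across [b] split there, and [b] becomes
    a breakpoint. *)
Lemma pw_approx_cat phi e a b c g1 K1 F1 g2 K2 F2 : a <= b -> b <= c ->
  pw_approx phi e a b g1 K1 F1 -> pw_approx phi e b c g2 K2 F2 ->
  exists g K F, pw_approx phi e a c g K F.
Proof.
move=> ab bc [e1 [ga1 gb1] k1 d1] [e2 [gb2 gc2] k2 d2].
pose g r := if r <= b then g1 r else g2 r; pose K := Num.max K1 K2.
have K1K : K1 <= K by rewrite le_max lexx.
have K2K : K2 <= K by rewrite le_max lexx orbT.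
exists g, K, (b :: F1 ++ F2); split.
- move=> r /andP[ar rc]; rewrite /g; have [rb|/ltW br] := leP r b.
    by apply: e1; rewrite ar.
  by apply: e2; rewrite br.
- split; first by rewrite /g ab.
  rewrite /g; have [cb|//] := leP c b.
  by have -> : c = b by apply/eqP; rewrite eq_le cb.
- move=> p q ap pq qc; rewrite /g.
  have [qb|bq] := leP q b.
    rewrite (le_trans pq qb); apply: le_trans (k1 _ _ _ _ _) _ => //.
    by rewrite ler_wpM2r// subr_ge0.
  have [pb|/ltW bp] := leP p b; last first.
    apply: le_trans (k2 _ _ _ _ _) _ => //.
    by rewrite ler_wpM2r// subr_ge0.
  apply: le_trans (ler_enorm_distD (g1 b) _ _) _.
  have := k1 p b ap pb (lexx _); have := k2 b q (lexx _) (ltW bq) qc.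
  rewrite gb1 gb2 => h2 h1.
  have := ler_wpM2r (ltac:(lra) : 0 <= q - b) K2K.
  have := ler_wpM2r (ltac:(lra) : 0 <= b - p) K1K.
  lra.
- move=> r /andP[ar rc].
  rewrite in_cons mem_cat !negb_or => /and3P[rb rF1 rF2].
  have [{}rb|br|/eqP] := ltgtP r b; last by rewrite (negbTE rb).
    have [|v dv] := d1 r _ rF1; first by rewrite ar.
    exists v; apply: is_derive1_itv dv; first by apply/andP; split; [exact: ar|exact: rb].
    by move=> s /andP[_ /ltW sb]; rewrite /g sb.
  have [|v dv] := d2 r _ rF2; first by rewrite br.
  exists v; apply: is_derive1_itv dv; first by apply/andP; split; [exact: br|exact: rc].
  by move=> s /andP[bs _]; rewrite /g leNgt bs.
Qed.

(** Chords are good approximations on short intervals by continuity, and [interval_induction] glues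
    finitely many of them. *)
Lemma ac_hist_space_dense (Delta : R) phi e : 0 <= Delta ->
  hist_space Delta phi -> 0 < e ->
  exists2 psi, ac_hist_space Delta psi & hist_norm Delta (psi \- phi) <= e.
Proof.
move=> D0 /hist_spaceP phic e0; have Dle0 : - Delta <= 0 by rewrite oppr_le0.
have [g [K [F [ge _ gK gd]]]] : exists g K F, pw_approx phi e (- Delta) 0 g K F.
  apply: (@interval_induction _ (fun s t => exists g K F, pw_approx phi e s t g K F)) => //.
    move=> r s t _ rs st _ [g1 [K1 [F1 h1]]] [g2 [K2 [F2 h2]]].
    exact: pw_approx_cat h1 h2.
  move=> r rD; have [d d0 hd] := phic r rD _ (divr_gt0 e0 (ltr0Sn R 3)).
  exists d => // s t Ds sr rt t0 tsd; apply: pw_approx_affine.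
    exact: le_trans rt.
  move=> q q' /andP[sq qt] /andP[sq' q't].
  apply: le_trans (ler_enorm_distD (phi r) _ _) _.
  have h1 : enorm (phi q - phi r) < e / 4.
    apply: hd; first by apply/andP; split; lra.
    by rewrite ltr_norml; apply/andP; split; lra.
  have h2 : enorm (phi q' - phi r) < e / 4.
    apply: hd; first by apply/andP; split; lra.
    by rewrite ltr_norml; apply/andP; split; lra.
  rewrite (enormBC (phi r)); lra.
exists g; last exact: hist_norm_le.
split; first exact: lipschitz_abs_continuous gK.
exists K.
have cF : countable [set` F] by apply: finite_set_countable; exact: finite_seq.
apply: ae_le (ae_notin_countable cF) => tau /negP tauF tauD.
have [v gv] := gd _ tauD tauF; split; first by case: gv.
have -> : 'D_1 g tau = v by case: gv.
exact: lipschitz_derive_le tauD gK gv.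
Qed.

Lemma ac_hist_space_sub (Delta : R) : 
  @ac_hist_space R Delta n `<=` @hist_space R Delta n.
Proof.
by move=> phi [phiac _]; apply/hist_spaceP; exact: abs_continuous_econtinuous.
Qed.

End Density.

(** * Limits of sequences with an explicit Cauchy rate *)

Section UniformLimits.
Variables (R : realType) (n : nat).

Lemma natSinv_lt (e : R) : 0 < e -> exists k : nat, k.+1%:R^-1 < e.
Proof.
move=> e0; have [k _ /(_ k) h] := near_infty_natSinv_lt (PosNum e0).
by exists k; apply: h => /=.
Qed.

Lemma le_natSinv (a b c : R) :
  (forall j : nat, a <= b + c * j.+1%:R^-1) -> a <= b.
Proof.
move=> abc; apply/ler_addgt0Pr => e e0.
have c1 : 0 < `|c| + 1 by rewrite ltr_wpDl.
have [j] := natSinv_lt (divr_gt0 e0 c1); rewrite ltr_pdivlMr// => jlt.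
apply: le_trans (abc j) _; rewrite lerD2l; apply: le_trans (ltW jlt).
by rewrite mulrC ler_wpM2l// (le_trans (ler_norm c))// lerDl.
Qed.

Lemma cauchy_rate_limit (y : nat -> 'rV[R]_n) (C : R) :
  (forall k j, enorm (y k - y j) <= C * (k.+1%:R^-1 + j.+1%:R^-1)) ->
  exists v, forall k, enorm (y k - v) <= C * k.+1%:R^-1.
Proof.
move=> yC.
have C0 : 0 <= C.
  have := le_trans (enorm_ge0 _) (yC 0%N 0%N).
  by rewrite invr1 pmulr_lge0.
have cv : cvgn y.
  apply: cauchy_cvg; apply: cauchy_exP => e e0.
  have C1 : 0 < 2 * (C + 1) by rewrite mulr_gt0// ltr_wpDl.
  have [k] := natSinv_lt (divr_gt0 e0 C1); rewrite ltr_pdivlMr// => ke.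
  exists (y k); exists k => // j /= kj.
  rewrite -ball_normE /=; apply: le_lt_trans (normr_le_enorm _) _.
  apply: le_lt_trans (yC k j) _; apply: le_lt_trans ke.
  have jk : j.+1%:R^-1 <= k.+1%:R^-1 :> R by rewrite lef_pV2 ?posrE// ler_nat.
  have k0 : 0 < k.+1%:R^-1 :> R by rewrite invr_gt0.
  move: k0 (ler_wpM2l C0 jk).
  set p := k.+1%:R^-1; set q := j.+1%:R^-1; lra.
(* For a large index [i >= j], the Cauchy bound contributes [C / (j + 1)] and the distance from
   [y i] to the limit [1 / (j + 1)], whence [C + 1]. *)
exists (limn y) => k; apply: (@le_natSinv _ _ (C + 1)) => j.
have j0 : 0 < j.+1%:R^-1 :> R by rewrite invr_gt0.
have j0' : 0 < j.+1%:R^-1 / n.+1%:R :> R by rewrite divr_gt0.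
move/cvgrPdist_lt : cv => /(_ _ j0')[N _ yN].
pose i := maxn N j.
have h1 : enorm (y i - limn y) <= j.+1%:R^-1.
  rewrite enormBC; apply: le_trans (enorm_le_normr _) _.
  have /ltW h := yN i (leq_maxl _ _).
  apply: (@le_trans _ _ (n.+1%:R * (j.+1%:R^-1 / n.+1%:R))).
    by apply: ler_pM => //; rewrite ler_nat.
  by rewrite mulrCA divff// mulr1.
have ij : i.+1%:R^-1 <= j.+1%:R^-1 :> R.
  by rewrite lef_pV2 ?posrE// ler_nat ltnS leq_maxr.
move: h1 ij (ler_wpM2l C0 ij) (yC k i) (ler_enorm_distD (y i) (y k) (limn y)).
set p := k.+1%:R^-1; set q := j.+1%:R^-1; set r := i.+1%:R^-1; lra.
Qed.

Lemma uniform_cauchy_limit (X : nat -> R -> 'rV[R]_n) (A : R -> Prop) (C : R) :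
  (forall k j t, A t ->
    enorm (X k t - X j t) <= C * (k.+1%:R^-1 + j.+1%:R^-1)) ->
  exists x, forall k t, A t -> enorm (X k t - x t) <= C * k.+1%:R^-1.
Proof.
move=> XC; have [|x xX] := @choice _ _ (fun t v =>
  A t -> forall k, enorm (X k t - v) <= C * k.+1%:R^-1).
  move=> t; have [At|nAt] := pselect (A t); last by exists 0.
  have [v hv] := @cauchy_rate_limit (fun k => X k t) C (fun k j => XC k j t At).
  by exists v.
by exists x => k t At; exact: xX.
Qed.

End UniformLimits.

(** * Stability, uniqueness, gluing, and existence over one period *)

Section Solutions.
Variables (R : realType) (Delta : R) (n m : nat).
Variable f : (R -> 'rV[R]_n) -> 'rV[R]_m -> 'rV[R]_n.
Hypotheses (hDelta : 0 <= Delta) (hf : lipschitz_on_bounded Delta f).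
Notation leb := (@lebesgue_measure R).
Implicit Types (x y phi psi : R -> 'rV[R]_n) (u : R -> 'rV[R]_m).

Lemma lipschitz_on_balls (M U : R) : exists2 L, 0 < L & forall phi psi v w,
  hist_space Delta phi -> hist_space Delta psi ->
  hist_norm Delta phi <= M -> hist_norm Delta psi <= M ->
  enorm v <= U -> enorm w <= U ->
  enorm (f phi v - f psi w) <=
    L * (hist_norm Delta (phi \- psi) + enorm (v - w)).
Proof.
have [||L HL] := hf (B := [set z | [/\ hist_space Delta z.1,
    hist_norm Delta z.1 <= M & enorm z.2 <= U]]).
- by move=> z [].
- exists (Num.max M U) => z [_ zM zU].
  by rewrite !le_max zM zU orbT.
exists (Num.max L 1); first by rewrite lt_max ltr01 orbT.
move=> phi psi v w hphi hpsi phiM psiM vU wU.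
apply: le_trans (HL (phi, v) (psi, w) _ _) _ => //=.
rewrite ler_wpM2r ?le_max ?lexx// addr_ge0 ?enorm_ge0//.
by apply: hist_norm_ge0 => //; exact: hist_spaceB.
Qed.

Lemma eq_hist_space phi psi :
  (forall tau, - Delta <= tau <= 0 -> phi tau = psi tau) ->
  hist_space Delta phi -> hist_space Delta psi.
Proof.
by move=> E /hist_spaceP h; apply/hist_spaceP; exact: eq_econtinuous h.
Qed.

Lemma eq_hist_norm phi psi :
  (forall tau, - Delta <= tau <= 0 -> phi tau = psi tau) ->
  hist_norm Delta phi = hist_norm Delta psi.
Proof.
move=> E; rewrite /hist_norm; congr sup; apply/seteqP; split=> _ [tau tD <-];
  by exists tau; rewrite // E.
Qed.

(** The argument of [f] is a function on all of R, but the Lipschitz bound is in [hist_norm], which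
    vanishes on [phi \- psi]; so [f] sees only the values on [[- Delta, 0]]. *)
Lemma rhs_local phi psi v : hist_space Delta phi ->
  (forall tau, - Delta <= tau <= 0 -> phi tau = psi tau) -> f phi v = f psi v.
Proof.
move=> hphi E; have hpsi := eq_hist_space E hphi.
have [L L0 HL] := lipschitz_on_balls (hist_norm Delta phi) (enorm v).
apply/eqP; rewrite -subr_eq0; apply/eqP/enorm0_eq0/le_anti; rewrite enorm_ge0 andbT.
apply: le_trans (HL phi psi v v hphi hpsi _ _ _ _) _ => //.
  by rewrite (eq_hist_norm E).
rewrite subrr enorm0 addr0 pmulr_rle0//; apply: hist_norm_le => // tau tD.
by rewrite /= E// subrr enorm0.
Qed.

(** A solution on a closed horizon with its initial state left free, suited to restriction, gluing
    and comparison. *)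
Definition solves u (T : R) x : Prop :=
  [/\ econtinuous x (- Delta) T, abs_continuous x 0 T
    & {ae leb, forall t, 0 < t < T -> is_derive t 1 x (f (hist x t) (u t))}].

Lemma solves_hist u T x t : solves u T x -> 0 <= t <= T ->
  hist_space Delta (hist x t).
Proof. by move=> [xc _ _]; exact: hist_space_hist. Qed.

Lemma solves_sub u T T' x : T' <= T -> solves u T x -> solves u T' x.
Proof.
move=> T'T [xc xac xd]; split.
- exact: econtinuous_sub xc.
- exact: abs_continuous_sub xac.
- apply: ae_le xd => t xt /andP[t0 tT']; apply: xt.
  by rewrite t0 (lt_le_trans tT').
Qed.

Lemma eq_solves u T x y : (forall t, - Delta <= t <= T -> x t = y t) ->
  solves u T x -> solves u T y.
Proof.
move=> xy xs; have [xc xac xd] := xs; split.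
- exact: eq_econtinuous xc.
- apply: eq_abs_continuous xac => t /andP[t0 tT]; apply: xy.
  by rewrite tT andbT; move: hDelta; lra.
- apply: ae_le xd => t xt t0T; have /andP[t0 tT] := t0T.
  have := xt t0T; rewrite (@rhs_local _ (hist y t)).
  + apply: is_derive1_itv t0T _ => s /andP[s0 sT]; apply: xy.
    by apply/andP; split; move: hDelta; lra.
  + by apply: solves_hist xs _; rewrite !ltW.
  + by move=> tau /andP[t1 t2]; apply: xy; apply/andP; split; lra.
Qed.

Lemma is_solution_solves x0 u b x T : hist_space Delta x0 ->
  is_solution Delta f x0 u b x -> 0 <= T -> (T%:E < b)%E -> solves u T x.
Proof.
move=> /hist_spaceP x0c [_ xx0 xac xd] T0 Tb; split.
- apply: (@econtinuous_cat _ _ _ _ 0) => //; first by rewrite oppr_le0.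
    by apply: eq_econtinuous x0c => t tD; rewrite xx0.
  exact/abs_continuous_econtinuous/xac.
- exact: xac.
- apply: ae_le xd => t xt /andP[t0 tT]; apply: xt; first exact: ltW.
  by apply: lt_trans Tb; rewrite lte_fin.
Qed.

Lemma solves_bounded u T x : 0 <= T -> solves u T x ->
  exists M, forall t, 0 <= t <= T -> hist_norm Delta (hist x t) <= M.
Proof.
move=> T0 [xc _ _]; have DT : - Delta <= T by move: hDelta; lra.
have [M xM] := econtinuous_bounded DT xc; exists M => t /andP[t0 tT].
apply: hist_norm_le => // tau /andP[tau1 tau2]; apply: xM.
by apply/andP; split; lra.
Qed.

(** On the ball of radius [M], [f] is Lipschitz with some constant [L]. Gronwall bounds the
    difference of the solutions by [C1] times the initial gap; put back into the derivative bound,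
    this yields the Lipschitz constant [L * C1] for the difference. *)
Lemma solves_stability u T M : 0 <= T -> input_space u ->
  exists2 C, 1 <= C & forall x y, solves u T x -> solves u T y ->
    (forall t, 0 <= t <= T -> hist_norm Delta (hist x t) <= M) ->
    (forall t, 0 <= t <= T -> hist_norm Delta (hist y t) <= M) ->
    (forall t, - Delta <= t <= T ->
       enorm (x t - y t) <= C * hist_norm Delta (x \- y)) /\
    (forall s t, 0 <= s -> s <= t -> t <= T ->
       enorm (x t - y t - (x s - y s)) <=
         C * hist_norm Delta (x \- y) * (t - s)).
Proof.
move=> T0 uU; have [L L0 HL] := lipschitz_on_balls M (fine (ess_norm u T)).
pose C1 := 3 * expR (2 * L * T).
have C11 : 1 <= C1.
  have : 1 <= expR (2 * L * T) by rewrite -expR0 ler_expR !mulr_ge0// ltW.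
  by rewrite /C1; lra.
exists (C1 * (1 + L)); first by nra.
move=> x y xs ys xM yM; set h := hist_norm Delta (x \- y).
have [xc xac xd] := xs; have [yc yac yd] := ys.
have zc : econtinuous (x \- y) (- Delta) T by exact: econtinuousB.
have hzs : hist_space Delta (x \- y).
  by apply/hist_spaceP; exact: econtinuous_sub zc.
have h0 : 0 <= h by exact: hist_norm_ge0.
have zac : abs_continuous (x \- y) 0 T by exact: abs_continuousB.
have zd : {ae leb, forall r, 0 < r < T -> exists2 v, is_derive r 1 (x \- y) v &
     enorm v <= L * hist_norm Delta (hist (x \- y) r)}.
  apply: ae_le (ae_and (ae_le_ess_norm uU T0) (ae_and xd yd)).
  move=> r [ru [xr yr]] rT; have /andP[r0 rT'] := rT.
  have rT2 : 0 <= r <= T by rewrite !ltW.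
  exists (f (hist x r) (u r) - f (hist y r) (u r)).
    by apply: is_deriveB; [exact: xr|exact: yr].
  have := HL _ _ (u r) (u r) (solves_hist xs rT2) (solves_hist ys rT2)
    (xM _ rT2) (yM _ rT2) (ru rT2) (ru rT2).
  by rewrite subrr enorm0 addr0.
have zT t : 0 <= t <= T -> enorm (x t - y t) <= C1 * h.
  exact: (gronwall_delay hDelta L0 T0 zc zac zd).
have zDT t : - Delta <= t <= T -> enorm (x t - y t) <= C1 * h.
  move=> /andP[Dt tT]; have [t0|/ltW t0] := leP t 0; last first.
    by apply: zT; rewrite t0.
  apply: (@le_trans _ _ h); last by rewrite ler_peMl.
  by apply: (@enorm_le_hist_norm _ _ _ hDelta (x \- y)) => //; rewrite Dt.
split=> [t tT|s t s0 st tT].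
  apply: le_trans (zDT t tT) _; rewrite ler_wpM2r//; nra.
have zd2 : {ae leb, forall r, 0 < r < T ->
    exists2 v, is_derive r 1 (x \- y) v & enorm v <= L * (C1 * h)}.
  apply: ae_le zd => r zr rT; have [v zv vL] := zr rT; exists v => //.
  apply: le_trans vL _; rewrite ler_wpM2l ?(ltW L0)//.
  apply: hist_norm_le => // tau /andP[tau1 tau2]; apply: zDT.
  by move: rT => /andP[r0 rT]; apply/andP; split; lra.
have LCh : 0 <= L * (C1 * h).
  by rewrite mulr_ge0 ?(ltW L0)// mulr_ge0//; exact: le_trans C11.
apply: le_trans (abs_continuous_lipschitz LCh zac zd2 s0 st tT) _.
rewrite ler_wpM2r ?subr_ge0//; have : 0 <= C1 * h.
  by rewrite mulr_ge0//; exact: le_trans C11.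
lra.
Qed.

Lemma solves_unique u T x y : 0 <= T -> input_space u ->
  solves u T x -> solves u T y ->
  (forall t, - Delta <= t <= 0 -> x t = y t) ->
  forall t, - Delta <= t <= T -> x t = y t.
Proof.
move=> T0 uU xs ys xy t tT.
have [M1 xM] := solves_bounded T0 xs; have [M2 yM] := solves_bounded T0 ys.
have [C C1 HC] := solves_stability (Num.max M1 M2) T0 uU.
have [||h _] := HC x y xs ys.
- by move=> s /xM; rewrite le_max => ->.
- by move=> s /yM; rewrite le_max => ->; rewrite orbT.
have := h t tT.
rewrite (@eq_hist_norm _ (fun=> 0)); last by move=> s /xy /= ->; rewrite subrr.
have -> : hist_norm Delta (fun=> 0 : 'rV[R]_n) = 0.
  apply/le_anti/andP; split.
    by apply: hist_norm_le => // *; rewrite enorm0.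
  apply: hist_norm_ge0 => //; apply/hist_spaceP => s _ e e0; exists 1 => // *.
  by rewrite subrr enorm0.
rewrite mulr0 => h0; apply/eqP; rewrite -subr_eq0; apply/eqP/enorm0_eq0.
by apply/le_anti; rewrite h0 enorm_ge0.
Qed.

(** The pieces overlap on [[A - Delta, A]], so the history of [z] at any time from [A] on is a
    history of [y]. *)
Lemma solves_cat u A B x y : 0 <= A -> 0 <= B -> solves u A x ->
  solves (fun t => u (A + t)) B y ->
  (forall tau, - Delta <= tau <= 0 -> y tau = x (A + tau)) ->
  exists z, [/\ solves u (A + B) z,
    forall t, - Delta <= t <= A -> z t = x t
    & forall t, - Delta <= t <= B -> z (A + t) = y t].
Proof.
move=> A0 B0 xs ys yx; pose z t := if t <= A then x t else y (t - A).
have zx t : t <= A -> z t = x t by rewrite /z => ->.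
have zy t : - Delta <= t -> z (A + t) = y t.
  rewrite /z => Dt; have [At|At] := leP (A + t) A; last first.
    by rewrite addrC addKr.
  by rewrite yx// Dt/=; lra.
have [xc xac xd] := xs; have [yc yac yd] := ys.
have zy' t : A - Delta <= t -> z t = y (t - A).
  move=> At; rewrite -zy; last by lra.
  by rewrite addrC subrK.
exists z; split=> [|t /andP[_ /zx]//|t /andP[/zy]//]; split.
- apply: (@econtinuous_cat _ _ _ _ A); rewrite ?lerDl//.
  + by move: hDelta; lra.
  + by apply: eq_econtinuous xc => t /andP[_ /zx].
  + apply: (@eq_econtinuous _ _ (fun t => y (- A + t))).
      by move=> t /andP[At _]; rewrite zy' 1?addrC//; move: hDelta; lra.
    have := @econtinuous_shift _ _ _ _ _ (- A) yc.
    by apply: econtinuous_sub; move: hDelta; lra.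
- apply: (@abs_continuous_cat _ _ _ _ A); rewrite ?lerDl//.
  + by apply: eq_abs_continuous xac => t /andP[_ /zx].
  + apply: (@eq_abs_continuous _ _ (fun t => y (t - A))).
      by move=> t /andP[At _]; rewrite zy'//; move: hDelta; lra.
    have := @abs_continuous_shift _ _ _ _ _ A yac.
    by rewrite add0r addrC.
(* At the switching time the one-sided derivatives may differ; this single point is discarded. *)
- have /= cA := ae_notin_countable (countable1 A).
  apply: ae_le (ae_and cA (ae_and xd (ae_shift (- A) yd))).
  move=> t [tA [xt yt]] /andP[t0 tAB].
  have [tltA|Altt|/tA//] := ltgtP t A.
    have t0A : 0 < t < A by rewrite t0.
    rewrite -(@rhs_local (hist x t)).
    + apply: is_derive1_itv t0A _ (xt t0A) => s /andP[_ /ltW sA].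
      by rewrite zx.
    + by apply: solves_hist xs _; rewrite !ltW.
    + by move=> tau /andP[_ tau0]; rewrite /hist zx//; lra.
  have tAB' : 0 < - A + t < B by apply/andP; split; lra.
  have := yt tAB'; rewrite addrA subrr add0r => /is_derive1_enormP yv.
  rewrite -(@rhs_local (hist y (- A + t))).
  + have Att : A < t < t + 1 by rewrite Altt/= ltrDl.
    apply: (@is_derive1_itv _ _ (fun s => y (- A + s))) Att _ _.
      move=> s /andP[As _]; rewrite zy' 1?addrC//; move: hDelta; lra.
    apply/is_derive1_enormP => e e0; have [d d0 yvd] := yv e e0.
    exists d => // s sd; have E : - A + s - (- A + t) = s - t by ring.
    by have := yvd (- A + s); rewrite !E; exact.
  + by apply: solves_hist ys _; case/andP: tAB' => /ltW -> /ltW ->.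
  + move=> tau /andP[tau1 tau2]; rewrite /hist zy'; last by lra.
    by congr y; ring.
Qed.

(** A common form for class N functions and linear gains, so that one argument serves both
    equivalences. *)
Definition gain (mu : R -> R) :=
  (forall s, 0 <= s -> 0 <= mu s) /\
  (forall s t, 0 <= s -> s <= t -> mu s <= mu t).

Variables (l T lambda : R) (mu : R -> R).
Hypotheses (l0 : 0 < l) (T0 : 0 < T) (lambda01 : 0 < lambda < 1).
Hypothesis mu_gain : gain mu.
Hypothesis est : finite_time_estimate Delta f l T lambda mu.

Definition period_solution x0 u x := [/\
  forall tau, - Delta <= tau <= 0 -> x tau = x0 tau,
  solves u T x,
  forall t, 0 <= t <= T -> hist_norm Delta (hist x t) <=
    l * hist_norm Delta x0 + mu (fine (ess_norm u t))
  & hist_norm Delta (hist x T) <=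
    lambda * hist_norm Delta x0 + mu (fine (ess_norm u T))].

Lemma ac_period_solution x0 u : ac_hist_space Delta x0 -> input_space u ->
  exists x, period_solution x0 u x.
Proof.
move=> x0W uU; have [b [x [[xs _] Tb xl xT]]] := est x0W uU.
exists x; split=> //; first by case: xs.
apply: is_solution_solves xs _ _ => //; [exact: ac_hist_space_sub|exact: ltW].
Qed.

(* The solutions from absolutely continuous approximations of x0 differ by
   functions with a small Lipschitz constant, so that their limit is
   differentiable wherever all of them are. *)
Lemma exists_period_solution x0 u : hist_space Delta x0 -> input_space u ->
  exists x, period_solution x0 u x.
Proof.
move=> x0c uU; have T0' := ltW T0.
have [mu0 mu_mono] := mu_gain.
pose inv k : R := k.+1%:R^-1.
have inv0 k : 0 < inv k by rewrite invr_gt0.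
have inv1 k : inv k <= 1 by rewrite invf_le1// ler1n.
have [psi psiP] := @choice _ _ (fun k p => ac_hist_space Delta p /\
    hist_norm Delta (p \- x0) <= inv k)
  (fun k => let: ex_intro2 p h1 h2 := ac_hist_space_dense hDelta x0c (inv0 k) in
     ex_intro _ p (conj h1 h2)).
have [X XP] := @choice _ _ (fun k x => period_solution (psi k) u x)
  (fun k => ac_period_solution (psiP k).1 uU).
have psic k : hist_space Delta (psi k).
  by apply: ac_hist_space_sub; case: (psiP k).
have psi_x0 k tau : - Delta <= tau <= 0 -> enorm (psi k tau - x0 tau) <= inv k.
  move=> tauD; apply: le_trans (psiP k).2.
  by apply: (@enorm_le_hist_norm _ _ _ hDelta (psi k \- x0)) => //; exact: hist_spaceB.
pose h0 := hist_norm Delta x0.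
have psi_le k : hist_norm Delta (psi k) <= h0 + inv k.
  apply: hist_norm_le => // tau tauD; rewrite -[psi k tau](subrK (x0 tau)).
  apply: le_trans (ler_enormD _ _) _; rewrite addrC lerD ?psi_x0//.
  exact: enorm_le_hist_norm.
pose muT := mu (fine (ess_norm u T)).
(* A radius common to all [X k]: the approximations of [x0] have norm at most [h0 + 1]. *)
pose M := l * (h0 + 1) + muT.
have XM k t : 0 <= t <= T -> hist_norm Delta (hist (X k) t) <= M.
  move=> tT; have [_ _ h _] := XP k; apply: le_trans (h t tT) _.
  have /andP[t0 tT'] := tT.
  rewrite lerD ?ler_wpM2l ?(ltW l0) ?(le_trans (psi_le k)) ?lerD2l//.
  by apply: mu_mono; [exact: fine_ess_norm_ge0|exact: le_fine_ess_norm].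
have Xs k : solves u T (X k) by case: (XP k).
have XX0 k tau : - Delta <= tau <= 0 -> enorm (X k tau - x0 tau) <= inv k.
  by move=> tauD; have [-> // _ _ _] := XP k; exact: psi_x0.
have hXX k j : hist_norm Delta (X k \- X j) <= inv k + inv j.
  apply: hist_norm_le => // tau tauD /=.
  apply: le_trans (ler_enorm_distD (x0 tau) _ _) _.
  by rewrite (enormBC (x0 tau)) lerD ?XX0.
have [C C1 stab] := solves_stability M T0' uU.
have C0 : 0 <= C by lra.
have XXC k j := stab _ _ (Xs k) (Xs j) (XM k) (XM j).
have [|x' x'X] := @uniform_cauchy_limit _ _ X (fun t => - Delta <= t <= T) C.
  move=> k j t tT; apply: le_trans ((XXC k j).1 t tT) _.
  by rewrite ler_wpM2l.
pose x t := if t <= 0 then x0 t else x' t.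
have xx0 tau : - Delta <= tau <= 0 -> x tau = x0 tau.
  by rewrite /x => /andP[_ ->].
have xX k t : - Delta <= t <= T -> enorm (X k t - x t) <= C * inv k.
  move=> tT; rewrite /x; have [t0|t0] := leP t 0; last exact: x'X.
  apply: le_trans (XX0 k t _) _; first by rewrite t0 andbT; case/andP: tT.
  by rewrite ler_peMl// ltW.
have xXlip k s t : 0 <= s -> s <= t -> t <= T ->
    enorm (X k t - x t - (X k s - x s)) <= C * inv k * (t - s).
  move=> s0 st tT; have DT r : 0 <= r -> r <= T -> - Delta <= r <= T.
    by move=> r0 rT; apply/andP; split; move: hDelta; lra.
  (* The Lipschitz bound for [X k - X j] passes to the limit in [j]. The term [C * (t - s)] comes
     from the initial gap, [2 * C] from replacing [X j] by [x] at [s] and at [t]. *)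
  apply: (@le_natSinv _ _ _ (C * (t - s) + 2 * C)) => j; rewrite -/(inv j).
  have -> : X k t - x t - (X k s - x s) =
      (X k t - X j t - (X k s - X j s)) + ((X j t - x t) - (X j s - x s)).
    by apply/rowP => i; rewrite !mxE; ring.
  apply: le_trans (ler_enormD _ _) _.
  have h1 := ler_enormB (X j t - x t) (X j s - x s).
  have h2 := xX j t (DT _ (le_trans s0 st) tT).
  have h3 := xX j s (DT _ s0 (le_trans st tT)).
  have h4 := (XXC k j).2 s t s0 st tT.
  have h5 : C * hist_norm Delta (X k \- X j) * (t - s) <=
      C * (inv k + inv j) * (t - s).
    by rewrite ler_wpM2r ?subr_ge0// ler_wpM2l.
  lra.
have xac : abs_continuous x 0 T.
  (* [x] is an absolutely continuous function minus a Lipschitz one. *)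
  apply: (@eq_abs_continuous _ _ (X 0%N \- (X 0%N \- x))).
    by move=> t _ /=; rewrite opprB addrC subrK.
  apply: abs_continuousB; first by have [_ ? _] := Xs 0%N.
  by apply: (@lipschitz_abs_continuous _ _ _ _ _ (C * inv 0%N)) => s t *; exact: xXlip.
have xc : econtinuous x (- Delta) T.
  apply: (@econtinuous_cat _ _ _ _ 0) => //; first by rewrite oppr_le0.
    by move/hist_spaceP : x0c; apply: eq_econtinuous => tau /xx0.
  exact: abs_continuous_econtinuous.
have xhist k t : 0 <= t <= T ->
    hist_norm Delta (hist x t) <= hist_norm Delta (hist (X k) t) + C * inv k.
  move=> tT; have /andP[t0 tT'] := tT.
  apply: hist_norm_le => // tau /andP[tau1 tau2]; rewrite /hist.
  rewrite -[x (t + tau)](subKr (X k (t + tau))).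
  apply: le_trans (ler_enormB _ _) _; apply: lerD.
    apply: (@enorm_le_hist_norm _ _ _ hDelta (hist (X k) t)); last by rewrite tau1.
    exact: solves_hist tT.
  by apply: xX; apply/andP; split; lra.
have xest t c (h : forall k, hist_norm Delta (hist (X k) t) <=
      c * hist_norm Delta (psi k) + mu (fine (ess_norm u t))) :
    0 <= c -> 0 <= t <= T ->
    hist_norm Delta (hist x t) <= c * h0 + mu (fine (ess_norm u t)).
  move=> c0 tT; apply: (@le_natSinv _ _ _ (c + C)) => k; rewrite -/(inv k).
  have := ler_wpM2l c0 (psi_le k); have := h k; have := xhist k t tT; lra.
have xM t : 0 <= t <= T -> hist_norm Delta (hist x t) <= M.
  move=> tT; apply: (@le_natSinv _ _ _ C) => k; rewrite -/(inv k).
  by apply: le_trans (xhist k t tT) _; rewrite lerD2r XM.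
exists x; split=> //; last 2 first.
- by move=> t tT; apply: xest; [move=> k; have [_ _ h _] := XP k; exact: h|exact: ltW|].
- apply: xest; [by move=> k; have [_ _ _ h] := XP k| |by rewrite T0' lexx].
  by case/andP: lambda01 => /ltW.
split=> //.
have [L L0 HL] := lipschitz_on_balls M (fine (ess_norm u T)).
have Xd : {ae leb, forall t, forall k, 0 < t < T ->
    is_derive t 1 (X k) (f (hist (X k) t) (u t))}.
  by apply: ae_all => k; have [_ _] := Xs k.
apply: ae_le (ae_and Xd (ae_le_ess_norm uU T0')) => t [Xt ut] t0T.
have tT : 0 <= t <= T by case/andP: t0T => /ltW -> /ltW ->.
have vk k : enorm (f (hist (X k) t) (u t) - f (hist x t) (u t)) <= L * (C * inv k).
  have xh : hist_space Delta (hist x t) by exact: hist_space_hist tT.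
  apply: le_trans (HL _ _ (u t) (u t) (solves_hist (Xs k) tT) xh
    (XM k _ tT) (xM _ tT) (ut tT) (ut tT)) _.
  rewrite subrr enorm0 addr0 ler_wpM2l ?(ltW L0)//.
  apply: hist_norm_le => // tau /andP[tau1 tau2]; apply: xX.
  by case/andP: tT => *; apply/andP; split; lra.
apply/is_derive1_enormP => e e0.
(* [C] measures the Lipschitz constant of [X k - x] and [L * C] the gap between right-hand sides,
   both times [inv k]; [k] makes their sum less than [e / 2]. *)
have CL0 : 0 < C + L * C by nra.
have [k] := natSinv_lt (divr_gt0 (divr_gt0 e0 (ltr0Sn R 1)) CL0).
rewrite -/(inv k) ltr_pdivlMr// => ke.
have /is_derive1_enormP/(_ _ (divr_gt0 e0 (ltr0Sn R 1)))[d d0 Xd'] := Xt k t0T.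
have /andP[t0 tT'] := t0T.
exists (Num.min d (Num.min t (T - t))).
  by rewrite !lt_min d0 t0 subr_gt0.
move=> s; rewrite !lt_min => /and3P[sd st sT].
have s0 : 0 <= s by move: st; rewrite ltr_norml => /andP[]; lra.
have sT' : s <= T by move: sT; rewrite ltr_norml => /andP[]; lra.
have lip : enorm (X k s - x s - (X k t - x t)) <= C * inv k * `|s - t|.
  have [ts|/ltW st'] := leP s t.
    rewrite enormBC distrC ger0_norm ?subr_ge0//; apply: xXlip => //.
    exact: ltW.
  by rewrite ger0_norm ?subr_ge0//; apply: xXlip => //; exact: ltW.
set v := f (hist x t) (u t); set w := f (hist (X k) t) (u t).
(* First-order remainder of [X k], increment of [X k - x], and difference of the right-hand
   sides. *)
have -> : x s - x t - (s - t) *: v = (X k s - X k t - (s - t) *: w)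
    - (X k s - x s - (X k t - x t)) + (s - t) *: (w - v).
  by apply/rowP => i; rewrite !mxE; ring.
apply: le_trans (ler_enormD _ _) _; rewrite enormZ.
have h1 := ler_enormB (X k s - X k t - (s - t) *: w) (X k s - x s - (X k t - x t)).
have h2 := Xd' s sd.
have h3 := ler_wpM2l (normr_ge0 (s - t)) (vk k).
have h4 := ler_wpM2r (normr_ge0 (s - t)) (ltW ke).
rewrite -/v -/w in h2 h3; lra.
Qed.

End Solutions.

(** * Iteration over periods and exponential decay *)

Section Iteration.
Variables (R : realType) (Delta : R) (n m : nat).
Variable f : (R -> 'rV[R]_n) -> 'rV[R]_m -> 'rV[R]_n.
Hypotheses (hDelta : 0 <= Delta) (hf : lipschitz_on_bounded Delta f).
Notation leb := (@lebesgue_measure R).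
Implicit Types (x y phi psi : R -> 'rV[R]_n) (u : R -> 'rV[R]_m).

Variables (l T lambda : R) (mu : R -> R).
Hypotheses (l0 : 0 < l) (T0 : 0 < T) (lambda01 : 0 < lambda < 1).
Hypothesis mu_gain : gain mu.
Hypothesis est : finite_time_estimate Delta f l T lambda mu.

Lemma mu_ess_norm_ge0 u t : 0 <= mu (fine (ess_norm u t)).
Proof. by apply: mu_gain.1; exact: fine_ess_norm_ge0. Qed.

Lemma mu_ess_norm_le u s t : input_space u -> 0 <= s -> s <= t ->
  mu (fine (ess_norm u s)) <= mu (fine (ess_norm u t)).
Proof.
move=> uU s0 st; apply: mu_gain.2; first exact: fine_ess_norm_ge0.
exact: le_fine_ess_norm.
Qed.

Lemma mu_ess_norm_shift u c t : input_space u -> 0 <= c -> 0 <= t ->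
  mu (fine (ess_norm (fun s => u (c + s)) t)) <= mu (fine (ess_norm u (c + t))).
Proof.
move=> uU c0 t0; apply: mu_gain.2; first exact: fine_ess_norm_ge0.
exact: fine_ess_norm_shift.
Qed.

(** The rate at which an exponential decreases by the factor [lambda] over one period. *)
Definition decay_rate := - ln lambda / T.

Lemma decay_rate_gt0 : 0 < decay_rate.
Proof. by rewrite divr_gt0// oppr_gt0 ln_lt0. Qed.

Lemma expR_decay N : expR (- decay_rate * (N%:R * T)) = lambda ^+ N.
Proof.
have [lambda0 _] := andP lambda01.
rewrite /decay_rate -mulNr opprK mulrCA divfK ?gt_eqF//.
by rewrite expRM_natl lnK.
Qed.

(** Induction on the number of periods. The contraction produces a geometric series in [lambda],
    with sum at most [(1 - lambda)^-1]; inside a period the state grows by at most the factor [l],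
    up to the input term. *)
Lemma exists_iterated_solution phi u N :
  hist_space Delta phi -> input_space u ->
  exists x, [/\ forall tau, - Delta <= tau <= 0 -> x tau = phi tau,
    solves Delta f u (N%:R * T) x,
    hist_norm Delta (hist x (N%:R * T)) <= lambda ^+ N * hist_norm Delta phi +
      (1 - lambda)^-1 * mu (fine (ess_norm u (N%:R * T)))
    & forall t, 0 <= t <= N%:R * T ->
      enorm (x t) <= (l / lambda + 1) * hist_norm Delta phi * expR (- decay_rate * t)
        + (l / (1 - lambda) + 1) * mu (fine (ess_norm u t))].
Proof.
move=> phic uU; have [lambda0 lambda1] := andP lambda01.
have lam0 : 0 <= 1 - lambda by lra.
set h := hist_norm Delta phi; have h0 : 0 <= h by exact: hist_norm_ge0.
elim: N => [|N [x [xphi xs xN xt]]].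
  rewrite mul0r; exists phi; split=> //.
  - split; first exact/hist_spaceP.
      apply: (@lipschitz_abs_continuous _ _ _ _ _ 0) => s t s0 st t0.
      have -> : t = s by lra.
      by rewrite !subrr enorm0 mulr0.
    by apply: aeW => t /andP[t0 /(lt_trans t0)]; rewrite ltxx.
  - rewrite expr0 mul1r (@eq_hist_norm _ _ _ _ phi); last first.
      by move=> tau _; rewrite /hist add0r.
    by rewrite lerDl mulr_ge0 ?invr_ge0// mu_ess_norm_ge0.
  - move=> t t0; have -> : t = 0 by apply/le_anti; rewrite andbC.
    rewrite mulr0 expR0 mulr1; apply: (@le_trans _ _ h).
      by apply: enorm_le_hist_norm => //; rewrite oppr_le0 hDelta lexx.
    apply: (@le_trans _ _ ((l / lambda + 1) * h)).
      by rewrite ler_peMl// lerDr divr_ge0// ltW.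
    by rewrite lerDl mulr_ge0 ?mu_ess_norm_ge0// addr_ge0// divr_ge0// ltW.
have NT0 : 0 <= N%:R * T by rewrite mulr_ge0// ltW.
have NTT : N.+1%:R * T = N%:R * T + T by rewrite -natr1 mulrDl mul1r.
have hc : hist_space Delta (hist x (N%:R * T)).
  by apply: solves_hist xs _; rewrite // lexx NT0.
have [y [yx ys yl yT]] := exists_period_solution hDelta hf l0 T0 lambda01 mu_gain
  est hc (input_space_shift NT0 uU).
have [z [zs zx zy]] := solves_cat hDelta hf NT0 (ltW T0) xs ys yx.
set g := (1 - lambda)^-1 in xN *.
have g0 : 0 <= g by rewrite invr_ge0.
exists z; split.
- move=> tau /andP[tau1 tau2]; rewrite zx ?xphi ?tau1//.
  exact: le_trans NT0.
- by rewrite NTT.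
- rewrite (@eq_hist_norm _ _ _ _ (hist y T)); last first.
    move=> tau /andP[tau1 tau2]; rewrite /hist NTT -addrA zy//.
    by apply/andP; split; move: T0; lra.
  apply: le_trans yT _.
  have h1 := mu_ess_norm_shift uU NT0 (ltW T0); rewrite -NTT in h1.
  have h2 : mu (fine (ess_norm u (N%:R * T))) <= mu (fine (ess_norm u (N.+1%:R * T))).
    by apply: mu_ess_norm_le => //; rewrite NTT lerDl ltW.
  have h3 := ler_wpM2l (ltW lambda0) xN.
  have h4 := ler_wpM2l (mulr_ge0 (ltW lambda0) g0) h2.
  rewrite exprS.
  set m1 := mu (fine (ess_norm u (N.+1%:R * T))) in h1 h2 h4 *.
  (* [g] is the fixed point of the recursion [g = lambda * g + 1] for the input term. *)
  have -> : g * m1 = lambda * g * m1 + m1.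
    rewrite -[X in _ + X]mul1r -mulrDl; congr (_ * _).
    have gE : g * (1 - lambda) = 1 by rewrite mulVf//; lra.
    lra.
  lra.
- move=> t /andP[t0 tN].
  have [tNT|/ltW NTt] := leP t (N%:R * T).
    rewrite zx ?tNT; first by apply: xt; rewrite t0.
    by rewrite andbT; move: hDelta; lra.
  pose s := t - N%:R * T.
  have s0 : 0 <= s by rewrite subr_ge0.
  have sT : s <= T by rewrite /s; lra.
  have tE : t = N%:R * T + s by rewrite addrC subrK.
  have -> : z t = y s by rewrite tE zy// sT andbT; move: hDelta; lra.
  have sT' : 0 <= s <= T by rewrite s0.
  have ysh : enorm (y s) <= hist_norm Delta (hist y s).
    have := @enorm_le_hist_norm _ _ _ hDelta (hist y s) 0 (solves_hist ys sT').
    by rewrite /hist addr0; apply; rewrite lexx andbT oppr_le0.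
  have h1 := mu_ess_norm_shift uU NT0 s0; rewrite -tE in h1.
  have h2 := mu_ess_norm_le uU NT0 NTt.
  have h3 := ler_wpM2l (ltW l0) xN.
  have h4 := ler_wpM2l (mulr_ge0 (ltW l0) g0) h2.
  (* Since [t] is at most [N.+1%:R * T], the exponential is at least [lambda ^+ N.+1]; this is the
     source of the division by [lambda] in the constant. *)
  have h5 : lambda ^+ N <= lambda^-1 * expR (- decay_rate * t).
    rewrite -(ler_pM2l lambda0) mulrA divff ?gt_eqF// mul1r -exprS -expR_decay.
    by rewrite ler_expR !mulNr lerN2 ler_wpM2l ?(ltW decay_rate_gt0).
  have h6 := ler_wpM2l (mulr_ge0 (ltW l0) h0) h5.
  have h7 : 0 <= h * expR (- decay_rate * t) by rewrite mulr_ge0 ?expR_ge0.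
  have := yl s sT'.
  rewrite -/g; set E := expR _ in h6 h7 *; lra.
Qed.

(** Iterated solutions agree on common horizons by uniqueness, hence define one global solution;
    uniqueness also makes every other solution a restriction of it. *)
Lemma finite_time_estimate_exp_ISS :
  exp_ISS_with Delta f (fun s => (l / (1 - lambda) + 1) * mu s).
Proof.
have [lambda0 lambda1] := andP lambda01.
exists (l / lambda + 1), decay_rate; split.
- by rewrite ltr_wpDl// divr_ge0// ltW.
- exact: decay_rate_gt0.
move=> phi u phic uU.
have [X XP] := choice (fun N => exists_iterated_solution N phic uU).
have NT_ge0 N : 0 <= N%:R * T :> R by rewrite mulr_ge0// ltW.
have NT_large t : exists N, t < N%:R * T.
  exists (Num.bound `|t / T|); rewrite -ltr_pdivrMr//.
  exact: le_lt_trans (ler_norm _) (archi_boundP (normr_ge0 _)).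
have X_agree N M t : - Delta <= t -> t <= N%:R * T -> t <= M%:R * T -> X N t = X M t.
  wlog NM : N M / (N <= M)%N.
    by move=> W; case: (leqP N M) => [|/ltnW] /W h *; [exact: h|apply/esym/h].
  move=> Dt tN _; have [XN sN _ _] := XP N; have [XM sM _ _] := XP M.
  have NMT : N%:R * T <= M%:R * T by rewrite ler_wpM2r ?(ltW T0)// ler_nat.
  apply: (solves_unique hDelta hf (NT_ge0 N) uU sN (solves_sub NMT sM)).
    by move=> tau tauD; rewrite XN// XM.
  by rewrite Dt.
have [I IP] := choice NT_large.
pose x t := X (I t) t.
have xX N t : - Delta <= t <= N%:R * T -> x t = X N t.
  by move=> /andP[Dt tN]; apply: X_agree => //; exact: ltW.
have xs N : solves Delta f u (N%:R * T) x.
  have [_ sN _ _] := XP N.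
  by apply: (eq_solves hDelta hf _ sN) => t tN; rewrite (xX N).
have xst t : 0 <= t -> solves Delta f u t x.
  by move=> t0; have [N /ltW tN] := NT_large t; exact: solves_sub tN (xs N).
have xphi tau : - Delta <= tau <= 0 -> x tau = phi tau.
  move=> tauD; have [X0 _ _ _] := XP 0%N.
  by rewrite (xX 0%N) ?X0// mul0r.
exists x.
  split; last first.
    move=> c y ys; split=> [|t t0 tc]; first exact: leey.
    have yst := is_solution_solves hDelta phic ys t0 tc.
    apply: (solves_unique hDelta hf t0 uU yst (xst t t0)).
      by move=> tau tauD; case: ys => _ -> // _ _; rewrite xphi.
    by rewrite lexx andbT; move: hDelta; lra.
  split=> //.
  - by move=> t t0 _; case: (xst t t0).
  (* [solves] gives the equation for positive times only, so time 0 is discarded as a null set. *)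
  - have /= c0 := ae_notin_countable (countable1 (0 : R)).
    apply: ae_le (ae_and c0 (ae_all (fun N => let: And3 _ _ h := xs N in h))).
    move=> t [t0 xd] tge0 _; have [N tN] := NT_large t.
    apply: (xd N); rewrite tN andbT lt_neqAle tge0 andbT.
    by apply/eqP => E; apply: t0; rewrite -E.
move=> t t0; have [N /ltW tN] := NT_large t; have [_ _ _ h] := XP N.
rewrite (xX N); first by apply: h; rewrite t0.
by rewrite tN andbT; move: hDelta; lra.
Qed.

End Iteration.

(** * From exp-ISS to the finite-time estimates *)

Section Converse.
Variables (R : realType) (Delta : R) (n m : nat).
Variable f : (R -> 'rV[R]_n) -> 'rV[R]_m -> 'rV[R]_n.
Hypothesis hDelta : 0 <= Delta.

Lemma exp_ISS_finite_time_estimate (mu : R -> R) : gain mu ->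
  exp_ISS_with Delta f mu ->
  exists l T lambda : R, [/\ 0 < l, 0 < T, 0 < lambda < 1
    & finite_time_estimate Delta f l T lambda mu].
Proof.
move=> [mu0 mu_mono] [k [eta [k0 eta0 iss]]].
(* In [1 + k], the 1 bounds the part of a history before time 0. The history at [T] lies after time
   [(k + 1) / eta], where the decay factor is at most [1 / (k + 2)] because
   [expR (k + 1) >= k + 2]. *)
exists (1 + k), (Delta + (k + 1) / eta), (k / (k + 2)).
set T := Delta + _; have T0 : 0 < T.
  by rewrite ltr_wpDl// divr_gt0// addr_gt0.
split=> //; first by rewrite addr_gt0.
  by rewrite divr_gt0 ?addr_gt0//= ltr_pdivrMr ?addr_gt0//; lra.
move=> phi u phiW uU; have phic := ac_hist_space_sub phiW.
have [x xmax xk] := iss phi u phic uU; exists +oo%E, x.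
set h := hist_norm Delta phi in xk *; have h0 : 0 <= h by exact: hist_norm_ge0.
have mu_le s t : 0 <= s -> s <= t ->
    mu (fine (ess_norm u s)) <= mu (fine (ess_norm u t)).
  move=> s0 st; apply: mu_mono; first exact: fine_ess_norm_ge0.
  exact: le_fine_ess_norm.
have mu_ge0 t : 0 <= mu (fine (ess_norm u t)).
  by apply: mu0; exact: fine_ess_norm_ge0.
split=> //; first exact: ltry.
- move=> t /andP[t0 tT]; apply: hist_norm_le => // tau /andP[tau1 tau2].
  rewrite /hist; have [tt|/ltW tt] := leP (t + tau) 0.
    have [[_ xphi _ _] _] := xmax.
    rewrite xphi; last by rewrite tt andbT; lra.
    apply: (@le_trans _ _ h).
      by apply: enorm_le_hist_norm => //; rewrite tt andbT; lra.
    by have := mu_ge0 t; have := mulr_ge0 (ltW k0) h0; lra.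
  apply: le_trans (xk _ tt) _; apply: lerD; last by apply: mu_le; lra.
  apply: (@le_trans _ _ (k * h)); last by rewrite ler_wpM2r// lerDr.
  rewrite ler_piMr ?mulr_ge0// ?(ltW k0)// -expR0 ler_expR mulNr oppr_le0.
  by rewrite mulr_ge0// ltW.
- apply: hist_norm_le => // tau /andP[tau1 tau2]; rewrite /hist.
  have kT : (k + 1) / eta <= T + tau by rewrite /T; lra.
  have tt : 0 <= T + tau by apply: le_trans kT; rewrite divr_ge0 ?addr_ge0// ltW.
  apply: le_trans (xk _ tt) _; apply: lerD; last by apply: mu_le; lra.
  rewrite mulrAC ler_wpM2r// ler_wpM2l ?(ltW k0)//.
  rewrite mulNr expRN lef_pV2 ?posrE ?expR_gt0 ?addr_gt0//.
  have : k + 1 <= eta * (T + tau) by rewrite mulrC -ler_pdivrMr.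
  move=> h1; apply: le_trans (expR_ge1Dx _); lra.
Qed.

End Converse.

(** * Class N and linear gains; the two equivalences *)

Lemma classN_gain (R : realType) (mu : R -> R) : classN mu -> gain mu.
Proof. by case. Qed.

Lemma linear_gain (R : realType) (mu0 : R) :
  0 <= mu0 -> gain (fun s : R => mu0 * s).
Proof. by move=> mu00; split=> [s|s t _]; [exact: mulr_ge0|exact: ler_wpM2l]. Qed.

Lemma classN_scale (R : realType) (c : R) (mu : R -> R) :
  0 <= c -> classN mu -> classN (fun s => c * mu s).
Proof.
move=> c0 [muc mu_ge0 mu_mono mu0]; split.
- by move=> t; apply: cvgM; [exact: cvg_cst|exact: muc].
- by move=> s s0; rewrite mulr_ge0// mu_ge0.
- by move=> s t s0 st; rewrite ler_wpM2l// mu_mono.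
- by rewrite mu0 mulr0.
Qed.

Theorem lemma3 (R : realType) (Delta : R) (n m : nat)
    (f : (R -> 'rV[R]_n) -> 'rV[R]_m -> 'rV[R]_n)
    (hDelta : 0 <= Delta) (hn : (1 <= n)%N) (hm : (1 <= m)%N)
    (hf : lipschitz_on_bounded Delta f)
    (hf0 : f (fun _ : R => 0) 0 = 0) :
  (exp_ISS Delta f <->
     exists (l T lambda : R) (mu : R -> R),
       [/\ 0 < l, 0 < T, 0 < lambda < 1, classN mu
         & finite_time_estimate Delta f l T lambda mu])
  /\
  (exp_ISS_linear_gain Delta f <->
     exists (l T lambda mu0 : R),
       [/\ 0 < l, 0 < T, 0 < lambda < 1, 0 <= mu0
         & finite_time_estimate Delta f l T lambda (fun s => mu0 * s)]).
Proof.
have c_ge0 (l lambda : R) : 0 < l -> 0 < lambda < 1 -> 0 <= l / (1 - lambda) + 1.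
  by move=> l0 /andP[_ lambda1]; rewrite addr_ge0// divr_ge0 ?(ltW l0)//; lra.
split; split.
- move=> [mu muN /(exp_ISS_finite_time_estimate hDelta (classN_gain muN))].
  by move=> [l [T [lambda [l0 T0 lambda01 est]]]]; exists l, T, lambda, mu.
- move=> [l [T [lambda [mu [l0 T0 lambda01 muN est]]]]].
  have := finite_time_estimate_exp_ISS hDelta hf l0 T0 lambda01 (classN_gain muN) est.
  by apply: ex_intro2; apply: classN_scale muN; exact: c_ge0.
- move=> [mu0 mu00 /(exp_ISS_finite_time_estimate hDelta (linear_gain mu00))].
  by move=> [l [T [lambda [l0 T0 lambda01 est]]]]; exists l, T, lambda, mu0.
- move=> [l [T [lambda [mu0 [l0 T0 lambda01 mu00 est]]]]].
  exists ((l / (1 - lambda) + 1) * mu0); first by rewrite mulr_ge0// c_ge0.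
  have := finite_time_estimate_exp_ISS hDelta hf l0 T0 lambda01 (linear_gain mu00) est.
  by congr (exp_ISS_with Delta f _); apply/funext => s; rewrite mulrA.
Qed.
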